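(* Let $(R,\mathfrak{m})$ be a commutative noetherian local ring, equipped with the $\mathfrak{m}$-adic topology, and let $I$ be an ideal of $R$. Let $M$ be a semi-discrete linearly compact $R$-module which is $I$-coartinian, and let $N$ be a finitely generated $R$-module with $\mathrm{dim}_{R}N\leq 2$. Then the $R$-module $\mathrm{Tor}_{i}^{R}(N,M)$ is $I$-coartinian for all $i\geq 0$.
   Context: $\mathrm{V}(I)=\{\mathfrak{p}\in\mathrm{Spec}R \mid I\subseteq \mathfrak{p}\}$. $\mathrm{dim}_RN$ is the Krull dimension ($-\infty$ if $N=0$). An $R$-module $L$ is cocyclic if it is (isomorphic to) a submodule of $E(R/\mathfrak{m})$, the injective envelope of $R/\mathfrak{m}$. The cosupport $\mathrm{Cosupp}_{R}M$ of an $R$-module $M$ is the set of prime ideals $\mathfrak{p}$ such that there is a cocyclic homomorphic image $L$ of $M$ with $\mathfrak{p}\supseteq \mathrm{Ann}_{R}L$. An $R$-module $M$ is $I$-coartinian if $\mathrm{Cosupp}_{R}M\subseteq \mathrm{V}(I)$ and $\mathrm{Tor}_{i}^{R}(R/I,M)$ is artinian for all $i\geq 0$. A topological $R$-module $M$ is linearly topologized if it has a base of neighborhoods of $0$ consisting of submodules; it is Hausdorff if the intersection of all neighborhoods of $0$ is $0$. A Hausdorff linearly topologized $R$-module $M$ is linearly compact if every family of closed cosets (cosets of closed submodules) of $M$ which has the finite intersection property has non-empty intersection. A Hausdorff linearly topologized $R$-module is semi-discrete if every submodule of it is closed. *)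

(* Defs.v *)
From HB Require Import structures.
From mathcomp Require Import all_boot all_order all_algebra.
From mathcomp Require Import generic_quotient ring_quotient finmap.
From mathcomp Require Import boolp classical_sets functions cardinality fsbigop.
From mathcomp Require Import topology.

Set Implicit Arguments.
Unset Strict Implicit.
Unset Printing Implicit Defensive.

Import GRing.Theory.
Local Open Scope classical_set_scope.
Local Open Scope quotient_scope.
Local Open Scope ring_scope.

(* Submodules of [V] are the boolean predicates of type [submodClosed V], and
   equality of submodules is [=i]. *)
Section Submodules.
Variables (R : comNzRingType) (V : lmodType R).

Record submod (S : submodClosed V) := Submod {
  submod_val : V;
  _ : submod_val \in (S : {pred V})
}.

Section Structure.
Variable S : submodClosed V.
HB.instance Definition _ := [isSub for @submod_val S].
HB.instance Definition _ := [Choice of submod S by <:].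
HB.instance Definition _ := [SubChoice_isSubLmodule of submod S by <:].
End Structure.

Definition span (A : set V) : {pred V} :=
  [pred x | `[< forall S : submodClosed V, (forall a, A a -> a \in S) ->
                  x \in S >]].

Lemma span_closed A : submod_closed (span A).
Proof.
split=> [|a u v /asboolP Su /asboolP Sv]; apply/asboolP => S SA.
  exact: rpred0.
by rewrite rpredD ?rpredZ ?Su ?Sv.
Qed.
HB.instance Definition _ A := GRing.isSubmodClosed.Build R V (span A)
  (span_closed A).

End Submodules.

Section QuotientModule.
Variables (R : comNzRingType) (V : lmodType R) (S : submodClosed V).

Definition submod_zmod : {pred V} := fun x => x \in S.

Lemma submod_zmod_closed : zmod_closed submod_zmod.
Proof.
split=> [|x y Sx Sy]; first exact: (rpred0 S).
by rewrite -scaleN1r; apply: (rpredD (S := S) Sx); apply: rpredZ.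
Qed.

HB.instance Definition _ :=
  GRing.isZmodClosed.Build V submod_zmod submod_zmod_closed.

Definition quotmod : Type := {ideal_quot submod_zmod}.
HB.instance Definition _ := GRing.Zmodule.on quotmod.
HB.instance Definition _ := EqQuotient.on quotmod.

Definition quot_pi (x : V) : quotmod := \pi_quotmod x.

Lemma quot_piE x y : (quot_pi x == quot_pi y) = (x - y \in S).
Proof. by rewrite -[RHS]/(x - y \in submod_zmod) Quotient.idealrBE. Qed.

Lemma quot_piK x : quot_pi (repr x) = x.
Proof. exact: reprK. Qed.

Lemma quot_piB : {morph quot_pi : x y / x - y}.
Proof. by move=> x y; rewrite /quot_pi !piE. Qed.

Lemma quot_piD : {morph quot_pi : x y / x + y}.
Proof. by move=> x y; rewrite /quot_pi !piE. Qed.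

Definition quot_scale (a : R) (x : quotmod) : quotmod := quot_pi (a *: repr x).

Lemma quot_pi_scale a x : quot_scale a (quot_pi x) = quot_pi (a *: x).
Proof.
apply/eqP; rewrite quot_piE -scalerBr rpredZ // -quot_piE.
by rewrite quot_piK.
Qed.

Lemma quot_scaleA a b x : quot_scale a (quot_scale b x) = quot_scale (a * b) x.
Proof. by rewrite -(quot_piK x) !quot_pi_scale scalerA. Qed.

Lemma quot_scale1 : left_id 1 quot_scale.
Proof. by move=> x; rewrite -(quot_piK x) quot_pi_scale scale1r. Qed.

Lemma quot_scaleDr : right_distributive quot_scale +%R.
Proof.
move=> a x y; rewrite -(quot_piK x) -(quot_piK y).
by rewrite -quot_piD !quot_pi_scale -quot_piD scalerDr.
Qed.

Lemma quot_scaleDl x : {morph quot_scale^~ x : a b / a + b}.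
Proof.
move=> a b; rewrite -(quot_piK x).
by rewrite !quot_pi_scale -quot_piD scalerDl.
Qed.

HB.instance Definition _ := GRing.Zmodule_isLmodule.Build R quotmod
  quot_scaleA quot_scale1 quot_scaleDr quot_scaleDl.

Lemma quot_pi_linear : linear quot_pi.
Proof. by move=> a x y; rewrite quot_piD -quot_pi_scale. Qed.

HB.instance Definition _ := GRing.isLinear.Build R V quotmod *:%R quot_pi
  quot_pi_linear.

End QuotientModule.

Section LinearMaps.
Variables (R : comNzRingType) (U V : lmodType R).

Definition lin_ker (f : U -> V) : {pred U} := [pred x | f x == 0].
Definition lin_im (f : U -> V) : {pred V} := [pred y | `[< exists x, f x = y >]].

Lemma lin_imP (f : U -> V) y : reflect (exists x, f x = y) (y \in lin_im f).
Proof. exact: asboolP. Qed.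

Lemma lin_ker_closed (f : {linear U -> V}) : submod_closed (lin_ker f).
Proof.
split=> [|a x y /eqP fx /eqP fy]; rewrite /lin_ker inE ?linear0 //.
by rewrite linearP fx fy scaler0 addr0.
Qed.
HB.instance Definition _ (f : {linear U -> V}) :=
  GRing.isSubmodClosed.Build R U (lin_ker f) (lin_ker_closed f).

End LinearMaps.

Section Homology.
Variables (R : comNzRingType) (U V W : lmodType R).
Variables (f : {linear U -> V}) (g : {linear V -> W}).

Definition boundary : {pred submod (lin_ker g)} :=
  fun z => submod_val z \in lin_im f.

Lemma boundaryP z : reflect (exists x, f x = submod_val z) (z \in boundary).
Proof. exact: lin_imP. Qed.

Lemma boundary_closed : submod_closed boundary.
Proof.
split=> [|a x y /boundaryP[u fu] /boundaryP[v fv]].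
  by apply/boundaryP; exists 0; rewrite linear0.
apply/boundaryP; exists (a *: u + v).
by rewrite linearP fu fv.
Qed.
HB.instance Definition _ :=
  GRing.isSubmodClosed.Build R (submod (lin_ker g)) boundary boundary_closed.

(* ker g / im f, for g \o f = 0. *)
Definition homology : Type := quotmod boundary.
HB.instance Definition _ := GRing.Lmodule.on homology.

End Homology.

Section FreeModule.
Variables (R : comNzRingType) (X : choiceType).

Definition fsupp : {pred (X -> R^o)} :=
  [pred c | `[< finite_set [set x | c x != 0] >]].

Lemma fsupp_closed : submod_closed fsupp.
Proof.
split=> [|a c d /asboolP cfin /asboolP dfin]; apply/asboolP.
  by rewrite (_ : [set _ | _] = set0) //; apply/seteqP; split=> x //= /eqP[].
apply: (@sub_finite_set _ _ ([set x | c x != 0] `|` [set x | d x != 0])).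
  move=> x /=; rewrite -[_ x]/(a *: c x + d x).
  have [->|] := eqVneq (c x) 0; last by left.
  by rewrite scaler0 add0r; right.
by rewrite finite_setU.
Qed.
HB.instance Definition _ :=
  GRing.isSubmodClosed.Build R (X -> R^o) fsupp fsupp_closed.

(* The free module R^(X): functions X -> R with finite support. *)
Definition freemod : Type := submod fsupp.
HB.instance Definition _ := GRing.Lmodule.on freemod.

Definition coeff (c : freemod) : X -> R := submod_val c.

Lemma basis_subproof x : (fun y => (y == x)%:R) \in fsupp.
Proof.
apply/asboolP; apply: (@sub_finite_set _ _ [set x]) => // y /=.
by case: (y =P x) => // _; rewrite eqxx.
Qed.
Definition basis x : freemod := Submod (basis_subproof x).

Lemma coeff_supp (c : freemod) :
  exists A : {fset X}, forall x, x \notin A -> coeff c x = 0.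
Proof.
case: c => c cP; have /asboolP/finite_fsetP[A cA] := cP.
exists A => x; apply: contraNeq => cx; suff: [set` A] x by [].
by rewrite -cA.
Qed.

Variables (V : lmodType R) (g : X -> V).

Definition free_lift (c : freemod) : V :=
  \sum_(x \in [set: X]) coeff c x *: g x.

Lemma free_liftE (A : {fset X}) (c : freemod) :
    (forall x, x \notin A -> coeff c x = 0) ->
  free_lift c = \sum_(x <- A) coeff c x *: g x.
Proof.
by move=> cA; apply: fsbigTE => x /cA->; rewrite scale0r.
Qed.

Lemma free_lift_linear : linear free_lift.
Proof.
move=> a c d; have [A cA] := coeff_supp c; have [B dB] := coeff_supp d.
have inAB x : x \notin (A `|` B)%fset -> coeff c x = 0 /\ coeff d x = 0.
  by rewrite in_fsetU negb_or => /andP[/cA-> /dB->].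
have coeffP x : coeff (a *: c + d) x = a * coeff c x + coeff d x by [].
have /free_liftE-> x : x \notin (A `|` B)%fset -> coeff c x = 0.
  by case/inAB.
have /free_liftE-> x : x \notin (A `|` B)%fset -> coeff d x = 0.
  by case/inAB.
have /free_liftE-> x : x \notin (A `|` B)%fset -> coeff (a *: c + d) x = 0.
  by case/inAB=> c0 d0; rewrite coeffP c0 d0 mulr0 addr0.
rewrite scaler_sumr -big_split; apply: eq_bigr => x _.
by rewrite coeffP /= scalerDl scalerA.
Qed.
HB.instance Definition _ := GRing.isLinear.Build R freemod V *:%R free_lift
  free_lift_linear.

Lemma free_lift_basis x : free_lift (basis x) = g x.
Proof.
rewrite (@free_liftE [fset x]%fset) => [|y].
  by rewrite big_seq_fset1 /coeff /= eqxx scale1r.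
by rewrite in_fset1 /coeff /= => /negPf->.
Qed.

End FreeModule.

Section Tensor.
Variables (R : comNzRingType) (N M : lmodType R).

Definition tensor_rel : set (freemod R (N * M)%type) :=
  [set w | (exists a x x' y, w = basis R (a *: x + x', y)
                               - (a *: basis R (x, y) + basis R (x', y)))
        \/ (exists a x y y', w = basis R (x, a *: y + y')
                               - (a *: basis R (x, y) + basis R (x, y')))].

Definition tensor : Type := quotmod (span tensor_rel).
HB.instance Definition _ := GRing.Lmodule.on tensor.

Definition tens (x : N) (y : M) : tensor :=
  quot_pi (span tensor_rel) (basis R (x, y)).

Lemma tens_linearl y : linear (tens^~ y).
Proof.
move=> a x x'; rewrite /tens -linearP; apply/eqP; rewrite quot_piE.
by apply/asboolP => S; apply; left; exists a, x, x', y.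
Qed.

Lemma tens_linearr x : linear (tens x).
Proof.
move=> a y y'; rewrite /tens -linearP; apply/eqP; rewrite quot_piE.
by apply/asboolP => S; apply; right; exists a, x, y, y'.
Qed.

Section Lift.
Variables (W : lmodType R) (b : N -> M -> W).

(* For bilinear [b], the linear map sending each [tens x y] to [b x y]. *)
Definition tensor_lift (t : tensor) : W := free_lift (fun p => b p.1 p.2) (repr t).

Hypothesis b_linearl : forall y, linear (b^~ y).
Hypothesis b_linearr : forall x, linear (b x).

Lemma tensor_lift_pi c :
  tensor_lift (quot_pi (span tensor_rel) c) = free_lift (fun p => b p.1 p.2) c.
Proof.
have [L LE] : exists L : {linear freemod R (N * M)%type -> W},
    L =1 free_lift (fun p => b p.1 p.2) by exists (free_lift (fun p => b p.1 p.2)).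
apply/eqP; rewrite -subr_eq0 /tensor_lift -!LE -linearB.
have /asboolP : repr (quot_pi (span tensor_rel) c) - c \in span tensor_rel.
  by rewrite -quot_piE quot_piK.
move=> /(_ (lin_ker L)); rewrite inE; apply=> w.
by case=> [[a [x [x' [y ->]]]]|[a [x [y [y' ->]]]]]; rewrite inE linearB linearP;
  rewrite !LE !free_lift_basis /= ?b_linearl ?b_linearr subrr.
Qed.

Lemma tensor_lift_linear : linear tensor_lift.
Proof.
move=> a s t; rewrite -(quot_piK s) -(quot_piK t) -linearP.
by rewrite !tensor_lift_pi linearP.
Qed.

End Lift.
End Tensor.

Section TensorMap.
Variables (R : comNzRingType) (N N' M : lmodType R) (f : {linear N -> N'}).

(* f (x) id_M *)
Definition tensor_map : tensor N M -> tensor N' M :=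
  tensor_lift (fun x y => tens (f x) y).

Lemma tensor_map_linear : linear tensor_map.
Proof.
apply: tensor_lift_linear => [y a x x'|x]; last exact: tens_linearr.
by rewrite linearP tens_linearl.
Qed.
HB.instance Definition _ :=
  GRing.isLinear.Build R (tensor N M) (tensor N' M) *:%R tensor_map
    tensor_map_linear.

End TensorMap.
Arguments tensor_map {R N N'} M f _.

Section Tor.
Variables (R : comNzRingType) (N M : lmodType R).

Definition free_cover (V : lmodType R) : freemod R V -> V := free_lift id.
HB.instance Definition _ V := GRing.Linear.on (@free_cover V).

(* The standard free resolution ... -> F_1 -> F_0 -> N -> 0 of N, where F_n is
   the free module on the underlying set of the n-th syzygy Z_n; Z_0 = N and
   Z_(n+1) is the kernel of F_n -> Z_n. *)
Fixpoint syzygy (n : nat) : lmodType R :=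
  if n is n'.+1 then submod (lin_ker (@free_cover (syzygy n'))) else N.

Definition resolution (n : nat) : lmodType R := freemod R (syzygy n).

Definition resolution_diff (n : nat) (c : resolution n.+1) : resolution n :=
  submod_val (free_cover c : syzygy n.+1).

Lemma resolution_diff_linear n : linear (@resolution_diff n).
Proof. by move=> a c d; rewrite /resolution_diff linearP. Qed.
HB.instance Definition _ n :=
  GRing.isLinear.Build R (resolution n.+1) (resolution n) *:%R
    (@resolution_diff n) (@resolution_diff_linear n).

(* Tor_i(N, M) = H_i(F (x) M), the differential leaving F_0 (x) M being 0. *)
Definition Tor (i : nat) : lmodType R :=
  if i is j.+1
  then homology (tensor_map M (@resolution_diff j.+1))
                (tensor_map M (@resolution_diff j))
  else homology (tensor_map M (@resolution_diff 0))
                (\0 : tensor (resolution 0) M -> tensor (resolution 0) M).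

End Tor.

Section Ideals.
Variable R : comNzRingType.

Definition ideal := submodClosed R^o.

Definition finitely_generated (V : lmodType R) (S : {pred V}) : Prop :=
  exists s : seq V, span [set` s] =i S.

Definition noetherian : Prop := forall J : ideal, finitely_generated J.

Definition maximal_ideal (m : ideal) : Prop :=
  1 \notin m /\
  forall J : ideal, 1 \notin J -> {subset m <= J} -> {subset J <= m}.

Definition local_ring (m : ideal) : Prop :=
  maximal_ideal m /\ forall m' : ideal, maximal_ideal m' -> m' =i m.

Fixpoint ideal_pow (J : ideal) (n : nat) : set R :=
  if n is n'.+1
  then [set x | exists2 s : seq (R * R),
          forall c, c \in s -> c.1 \in J /\ ideal_pow J n' c.2
          & x = \sum_(c <- s) c.1 * c.2]
  else setT.

(* [prime_idealr R] is Spec R: its elements are proper prime ideals. *)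
Definition V_ideal (J : ideal) : set (prime_idealr R) :=
  [set p : prime_idealr R | {subset J <= (p : {pred R})}].

Definition ann (L : lmodType R) : {pred R} :=
  [pred r | `[< forall x : L, r *: x = 0 >]].

(* Every chain p_0 < ... < p_n of primes containing Ann N has n <= d; for
   finitely generated N these are the chains of Supp N.  There is no chain when
   N = 0, in accordance with dim 0 = -oo. *)
Definition krull_dim_le (N : lmodType R) (d : nat) : Prop :=
  forall (n : nat) (p : nat -> prime_idealr R),
    {subset ann N <= (p 0%N : {pred R})} ->
    (forall i, (i < n)%N -> {subset (p i : {pred R}) <= (p i.+1 : {pred R})}
                     /\ ~ {subset (p i.+1 : {pred R}) <= (p i : {pred R})}) ->
  (n <= d)%N.

Definition artinian (V : lmodType R) : Prop :=
  forall S : nat -> submodClosed V,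
    (forall n, {subset S n.+1 <= S n}) ->
  exists n, forall k, (n <= k)%N -> S k =i S n.

Definition injective_module (E : lmodType R) : Prop :=
  forall (A B : lmodType R) (i : {linear A -> B}) (f : {linear A -> E}),
    injective i -> exists g : {linear B -> E}, forall a, g (i a) = f a.

Definition injective_envelope (A E : lmodType R) : Prop :=
  injective_module E /\
  exists2 j : {linear A -> E}, injective j &
    forall S : submodClosed E, (exists2 x, x \in S & x != 0) ->
      exists2 a, j a \in S & j a != 0.

Section Coartinian.
Variable m : ideal.

Definition cocyclic (L : lmodType R) : Prop :=
  exists2 E : lmodType R, injective_envelope (quotmod m) E &
    exists f : {linear L -> E}, injective f.

Definition cosupp (M : lmodType R) : set (prime_idealr R) :=
  [set p : prime_idealr R | exists2 L : lmodType R,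
     cocyclic L /\ (exists f : {linear M -> L}, forall y, exists x, f x = y)
     & {subset ann L <= (p : {pred R})}].

Definition coartinian (J : ideal) (M : lmodType R) : Prop :=
  cosupp M `<=` V_ideal J /\ forall i : nat, artinian (Tor (quotmod J) M i).

End Coartinian.
End Ideals.

(* A module with a topology; their compatibility is [topological_module]. *)
#[short(type="preTopLmodType")]
HB.structure Definition PreTopLmod (R : comNzRingType) :=
  {M of Topological M & GRing.Lmodule R M}.

Section LinearlyCompact.
Variables (R : comNzRingType) (m : ideal R) (M : preTopLmodType R).

Definition madic_nbhs (r : R) : set_system R :=
  [set U | exists n, [set s | ideal_pow m n (s - r)] `<=` U].

Definition topological_module : Prop :=
  [/\ continuous (fun z : M * M => z.1 + z.2),
      continuous (fun x : M => - x)
    & forall (r : R) (x : M),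
        (fun z : R * M => z.1 *: z.2) @ filter_prod (madic_nbhs r) (nbhs x)
          --> r *: x].

Definition linearly_topologized : Prop :=
  forall U : set M, nbhs 0 U ->
    exists2 S : submodClosed M, nbhs 0 [set` S] & [set` S] `<=` U.

Definition nbhs0_hausdorff : Prop := \bigcap_(U in nbhs (0 : M)) U = [set 0].

Definition hausdorff_linearly_topologized : Prop :=
  [/\ topological_module, linearly_topologized & nbhs0_hausdorff].

Definition closed_coset (C : set M) : Prop :=
  exists2 S : submodClosed M, closed [set` S] &
    exists x, C = [set y | y - x \in S].

Definition linearly_compact : Prop :=
  hausdorff_linearly_topologized /\
  forall F : set (set M), (forall C, F C -> closed_coset C) -> finI F id ->
    \bigcap_(C in F) C !=set0.

Definition semi_discrete : Prop :=
  hausdorff_linearly_topologized /\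
  forall S : submodClosed M, closed [set` S].

End LinearlyCompact.

(* Main.v *)
(* Write T = Tor_i(N, M).  The standard resolution P of a finitely generated N
   over a noetherian ring has, in each degree, an endomorphism of finite rank which
   is homotopic to the identity, so T is a subquotient of a finite power of M and
   every Serre class containing M contains T.  Four Serre classes are used: modules
   all of whose quotients have finite-dimensional socles; modules whose cyclic
   submodules R x satisfy Supp(R x / I x) <= {m}; for b in I and m, modules V such
   that b^n V lies in a finitely generated submodule for some n; and the trivial
   modules, for b in I outside m (then M = 0).

   M lies in the first class by linear compactness, hence has a finitely generated
   submodule B with M / B m-torsion, and M lies in the second class since M / I M
   is artinian.  For b in I the chain b^n M + B is stationary, and it must end at
   B: otherwise some cocyclic quotient of M would not be killed by a power of b,
   against Cosupp M <= V(I).  So M lies in the third class.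

   Conversely, Tor_j(R/I, T) is in the first two classes and killed by I, hence it
   is m-torsion with finite-dimensional socles, i.e. artinian; and a cocyclic
   quotient of T is m-torsion, so the third class makes it killed by a power of b.

   The injective envelope of R/m is never constructed: cocyclic quotients of M are
   only needed when a cocyclic quotient of T, which comes with an envelope, is
   given. *)
From HB Require Import structures.
From mathcomp Require Import all_boot all_algebra.
From mathcomp Require Import ring_quotient finmap.
From mathcomp Require Import boolp classical_sets functions.
From mathcomp Require Import topology.
Require Import Defs.

Set Implicit Arguments.
Unset Strict Implicit.
Unset Printing Implicit Defensive.

Import GRing.Theory.
Local Open Scope classical_set_scope.
Local Open Scope ring_scope.

(** * Submodules as propositional sets: sums, images, finite spans, Zorn's lemma *)

Section Submodule.
Variables (R : comNzRingType).
Implicit Types V W : lmodType R.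

(** A property of plain sets, so that sums, images and unions need no packing; [submodule_pred]
    returns to [submodClosed] when a quotient is formed. *)
Definition submodule V (A : set V) : Prop :=
  A 0 /\ forall a u v, A u -> A v -> A (a *: u + v).

Section Basics.
Variables (V : lmodType R) (A : set V).
Hypothesis smA : submodule A.

Lemma submodule0 : A 0. Proof. by case: smA. Qed.

Lemma submoduleD u v : A u -> A v -> A (u + v).
Proof. by rewrite -{2}(scale1r u); apply: smA.2. Qed.

Lemma submoduleZ a u : A u -> A (a *: u).
Proof. by move=> Au; rewrite -[_ *: _]addr0; apply: smA.2 => //; apply: submodule0. Qed.

Lemma submoduleN u : A u -> A (- u).
Proof. by rewrite -scaleN1r; apply: submoduleZ. Qed.

Lemma submoduleB u v : A u -> A v -> A (u - v).
Proof. by move=> Au /submoduleN; apply: submoduleD. Qed.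

Lemma submodule_subl u v : A v -> A (u - v) -> A u.
Proof. by move=> Av /submoduleD/(_ Av); rewrite subrK. Qed.

Lemma submodule_pred : exists S : submodClosed V, forall x, x \in S <-> A x.
Proof.
pose P : {pred V} := [pred x | `[< A x >]].
have Pc : submod_closed P.
  by split=> [|a u v /asboolP Au /asboolP Av]; apply/asboolP;
    [apply: submodule0 | apply: smA.2].
pose Pb := GRing.isSubmodClosed.Build R V P Pc.
pose S : submodClosed V := HB.pack P Pb.
by exists S => x; split=> [/asboolP|Ax] //; apply/asboolP.
Qed.

End Basics.

Lemma submodule_mem V (S : submodClosed V) : submodule [set x | x \in S].
Proof. by split=> [|a u v Su Sv] /=; [apply: rpred0 | rewrite rpredD ?rpredZ]. Qed.

Lemma submodule_set0 V : submodule [set (0 : V)].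
Proof. by split=> // a u v /= -> ->; rewrite scaler0 addr0. Qed.

Lemma submodule_preim V W (f : {linear V -> W}) (A : set W) :
  submodule A -> submodule (f @^-1` A).
Proof.
by move=> smA; split=> [|a u v] /=; rewrite ?linear0 ?linearP;
  [apply: submodule0 | apply: smA.2].
Qed.

Lemma submodule_image V W (f : {linear V -> W}) (A : set V) :
  submodule A -> submodule (f @` A).
Proof.
move=> smA; split=> [|a _ _ [u Au <-] [v Av <-]].
  by exists 0; [apply: submodule0 | rewrite linear0].
by exists (a *: u + v); [apply: smA.2 | rewrite linearP].
Qed.

Lemma submoduleI V (A B : set V) :
  submodule A -> submodule B -> submodule (A `&` B).
Proof.
move=> smA smB; split=> [|a u v [Au Bu] [Av Bv]].
  by split; apply: submodule0.
by split; [apply: smA.2 | apply: smB.2].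
Qed.

Definition addm V (A B : set V) : set V :=
  [set x | exists u v, [/\ A u, B v & x = u + v]].

Lemma submodule_addm V (A B : set V) :
  submodule A -> submodule B -> submodule (addm A B).
Proof.
move=> smA smB; split=> [|a _ _ [u [v [Au Bv ->]]] [u' [v' [Au' Bv' ->]]]].
  by exists 0, 0; split; rewrite ?addr0 //; apply: submodule0.
exists (a *: u + u'), (a *: v + v'); split; [exact: smA.2|exact: smB.2|].
by rewrite scalerDr addrACA.
Qed.

Lemma addm_subl V (A B : set V) : submodule B -> A `<=` addm A B.
Proof. by move=> smB x Ax; exists x, 0; split; rewrite ?addr0 //; apply: submodule0. Qed.

Lemma addm_subr V (A B : set V) : submodule A -> B `<=` addm A B.
Proof. by move=> smA x Bx; exists 0, x; split; rewrite ?add0r //; apply: submodule0. Qed.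

Lemma addm_sub V (A B C : set V) :
  submodule C -> A `<=` C -> B `<=` C -> addm A B `<=` C.
Proof.
by move=> smC AC BC _ [u [v [/AC Cu /BC Cv ->]]]; apply: submoduleD.
Qed.

Definition colon V (b : R) (A : set V) : set V := [set x | A (b *: x)].

Lemma submodule_colon V b (A : set V) : submodule A -> submodule (colon b A).
Proof.
move=> smA; split=> [|a u v]; rewrite /colon /=.
  by rewrite scaler0; apply: submodule0.
by rewrite scalerDr scalerA mulrC -scalerA; apply: smA.2.
Qed.

(** Agrees with [span] by [lspan_spanE]; the recursive form allows induction on the generators. *)
Fixpoint lspan V (s : seq V) : set V :=
  if s is x :: s' then [set y | exists a v, lspan s' v /\ y = a *: x + v]
  else [set 0].

Lemma submodule_lspan V (s : seq V) : submodule (lspan s).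
Proof.
elim: s => [|x s IHs]; first exact: submodule_set0.
split=> [|a _ _ [b [v [sv ->]]] [c [w [sw ->]]]].
  by exists 0, 0; split; rewrite ?scale0r ?addr0 //; apply: submodule0.
exists (a * b + c), (a *: v + w); split; first exact: IHs.2.
by rewrite scalerDr scalerA scalerDl addrACA.
Qed.

Lemma mem_lspan V (s : seq V) x : x \in s -> lspan s x.
Proof.
elim: s => // y s IHs; rewrite inE => /orP[/eqP->|/IHs sx] /=.
  by exists 1, 0; rewrite scale1r addr0; split=> //; apply: submodule0; apply: submodule_lspan.
by exists 0, x; rewrite scale0r add0r.
Qed.

Lemma lspan_sub V (s : seq V) (A : set V) :
  submodule A -> (forall x, x \in s -> A x) -> lspan s `<=` A.
Proof.
move=> smA; elim: s => [|y s IHs] sA x /=; first by move->; apply: submodule0.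
case=> a [v [sv ->]]; apply: smA.2; first by apply: sA; rewrite mem_head.
by apply: IHs sv => z zs; apply: sA; rewrite inE zs orbT.
Qed.

Lemma lspan_subseq V (s t : seq V) : {subset s <= t} -> lspan s `<=` lspan t.
Proof.
by move=> st; apply: lspan_sub; [apply: submodule_lspan | move=> x /st/mem_lspan].
Qed.

Lemma lspan_spanE V (s : seq V) x : x \in span [set` s] <-> lspan s x.
Proof.
split=> [/asboolP xs|].
  have [S SE] := submodule_pred (submodule_lspan s).
  by apply/SE/xs => y /mem_lspan/SE.
move: x; apply: (lspan_sub (submodule_mem (span [set` s]))).
by move=> y ys; apply/asboolP => S; apply.
Qed.

Lemma lspan_map V W (f : {linear V -> W}) (s : seq V) :
  lspan (map f s) = f @` lspan s.
Proof.
apply/seteqP; split.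
  apply: lspan_sub => [|_ /mapP[x xs ->]].
    by apply: submodule_image; apply: submodule_lspan.
  by exists x => //; apply: mem_lspan.
move=> _ [x sx <-]; move: x sx.
apply: (lspan_sub (submodule_preim f (submodule_lspan (map f s)))) => y ys.
by apply: mem_lspan; apply: map_f.
Qed.

Lemma image_map V W (f : V -> W) (A : set V) (t : seq W) :
  (forall y, y \in t -> (f @` A) y) ->
  exists2 s, (forall x, x \in s -> A x) & map f s = t.
Proof.
elim: t => [|y t IHt] tA; first by exists [::].
have [|s sA <-] := IHt; first by move=> z zt; apply: tA; rewrite inE zt orbT.
have [x Ax <-] := tA y (mem_head _ _); exists (x :: s) => // z.
by rewrite inE => /orP[/eqP->|/sA].
Qed.

(* The condition A0 `&` X `<=` Y with arbitrary X and Y covers maximality among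
   the K with K `&` B = U, among the K avoiding a point, and among the ideals
   avoiding a multiplicative set. *)
Lemma submodule_Zorn V (A0 X Y : set V) : submodule A0 -> A0 `&` X `<=` Y ->
  exists K, [/\ submodule K, A0 `<=` K, K `&` X `<=` Y &
    forall K', submodule K' -> K `<=` K' -> K' `&` X `<=` Y -> K' `<=` K].
Proof.
move=> smA0 A0X.
pose P A := A = set0 \/ [/\ submodule A, A0 `<=` A & A `&` X `<=` Y].
have [F FP Ftot|K [[K0|[smK A0K KX]] Kmax]] := @Zorn_bigcup V P.
- have [[A FA An0]|F0] := pselect (exists2 A, F A & A !=set0); last first.
    left; apply/seteqP; split=> // x [A FA Ax]; apply: F0.
    by exists A => //; exists x.
  have good B : F B -> B !=set0 -> [/\ submodule B, A0 `<=` B & B `&` X `<=` Y].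
    by move=> /FP[->|//] [].
  have [smA A0A _] := good _ FA An0.
  right; split; last by move=> x [[B FB Bx] Xx]; have [|_ _] := good _ FB; [exists x|apply].
  + split; first by exists A => //; apply: submodule0.
    move=> a u v [B FB Bu] [C FC Cv].
    have [smB _ _] : [/\ submodule B, A0 `<=` B & B `&` X `<=` Y].
      by apply: good => //; exists u.
    have [smC _ _] : [/\ submodule C, A0 `<=` C & C `&` X `<=` Y].
      by apply: good => //; exists v.
    have [BC|CB] := Ftot B C FB FC.
      by exists C => //; apply: smC.2 => //; apply: BC.
    by exists B => //; apply: smB.2 => //; apply: CB.
  + by move=> x /A0A Ax; exists A.
- exfalso; apply: (Kmax A0); last by right; split=> // x.
  rewrite K0; split=> [x []|A00].
  by have := A00 0 (submodule0 smA0).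
- exists K; split=> // K' smK' KK' K'X; apply: contrapT => nK'K.
  by apply: (Kmax K'); [split|right; split=> // x /A0K/KK'].
Qed.

Lemma repr_quot_pi V (S : submodClosed V) x : repr (quot_pi S x) - x \in S.
Proof. by rewrite -quot_piE quot_piK. Qed.

End Submodule.

(** * Noetherian rings: finitely generated submodules and stationary chains *)

Section Noetherian.
Variables (R : comNzRingType) (noethR : noetherian R).
Implicit Types V W : lmodType R.

Lemma noetherian_ideal (J : set R^o) : submodule J -> exists s, lspan s = J.
Proof.
move=> smJ; have [S SE] := submodule_pred smJ; have [s sS] := noethR S.
exists s; apply/seteqP; split=> x.
  by move/lspan_spanE; rewrite sS => /SE.
by move/SE; rewrite -sS => /lspan_spanE.
Qed.

(** Induction on the generators. The coefficients at [x] of elements of [A] form an ideal [J]; lifts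
    [w] of generators of [J], together with generators [t] of the part of [A] inside <s>, generate
    [A]. *)
Lemma noetherian_sub V (s : seq V) (A : set V) :
  submodule A -> A `<=` lspan s -> exists t, lspan t = A.
Proof.
elim: s A => [|x s IHs] A smA As.
  exists [::]; apply/seteqP; split=> [y ->|y /As //]; exact: submodule0.
have sms := submodule_lspan s.
pose J : set R^o := [set r | exists v, lspan s v /\ A (r *: x + v)].
have smJ : submodule J.
  split=> [|a r r' [v [sv Av]] [w [sw Aw]]].
    by exists 0; rewrite scale0r addr0; split; apply: submodule0.
  exists (a *: v + w); split; first exact: sms.2.
  by rewrite scalerDl -scalerA addrACA -scalerDr; apply: smA.2.
have [rs rsJ] := noetherian_ideal smJ.
have [t tA] : exists t, lspan t = A `&` lspan s.
  by apply: IHs => [|y []//]; apply: submoduleI.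
have /choice[g gP] (r : R) : exists v, J r -> lspan s v /\ A (r *: x + v).
  by have [[v vP]|nJ] := pselect (J r); [exists v | exists 0].
pose w := [seq (r : R) *: x + g r | r <- rs].
have wA y : y \in w -> A y.
  case/mapP=> r rrs ->; have : lspan rs r by apply: mem_lspan.
  by rewrite rsJ => /gP[].
exists (w ++ t); apply/seteqP; split.
  apply: lspan_sub => // y; rewrite mem_cat => /orP[/wA//|/mem_lspan].
  by rewrite tA => -[].
move=> y Ay; have /= [a [v [sv yE]]] := As y Ay.
have : J a by exists v; rewrite -yE.
rewrite -rsJ => rsa.
(* An element of <w> with the same coefficient [a] at [x] as [y]; the difference [y - y0] then lies
   in <t>. *)
have [y0 [v0 [wy0 sv0 y0E]]] :
    exists y0 v0, [/\ lspan w y0, lspan s v0 & y0 = a *: x + v0].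
  pose K : set R^o := [set a | exists y0 v0,
    [/\ lspan w y0, lspan s v0 & y0 = a *: x + v0]].
  have smK : submodule K.
    split=> [|b r r' [y0 [v0 [wy0 sv0 y0E]]] [y1 [v1 [wy1 sv1 y1E]]]].
      by exists 0, 0; split; rewrite ?scale0r ?addr0 //;
        apply: submodule0; apply: submodule_lspan.
    exists (b *: y0 + y1), (b *: v0 + v1); split.
    + by apply: (submodule_lspan _).2.
    + exact: sms.2.
    + by rewrite y0E y1E scalerDl scalerDr scalerA addrACA.
  apply: (lspan_sub smK) rsa => r rrs.
  have [|sg _] := gP r; first by rewrite -rsJ; apply: mem_lspan.
  by exists (r *: x + g r), (g r); split=> //; apply: mem_lspan; apply: map_f.
have Ay0 : A y0 by apply: (lspan_sub smA) wy0.
apply: (submodule_subl (submodule_lspan _) (v := y0)).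
  by apply: lspan_subseq wy0 => z zw; rewrite mem_cat zw.
apply: (@lspan_subseq _ _ t) => [z zt|]; first by rewrite mem_cat zt orbT.
rewrite tA; split; first exact: submoduleB.
by rewrite yE y0E opprD addrACA subrr add0r; apply: submoduleB.
Qed.

Lemma chain_homo T (A : nat -> set T) : (forall n, A n `<=` A n.+1) ->
  forall n k, (n <= k)%N -> A n `<=` A k.
Proof.
move=> Ah n k /subnK <-; elim: (k - n)%N => //= j IHj x /IHj.
by rewrite addSn; apply: Ah.
Qed.

Lemma chain_seq (T : eqType) (A : nat -> set T) (s : seq T) :
    (forall n, A n `<=` A n.+1) -> (forall x, x \in s -> exists n, A n x) ->
  exists n, forall x, x \in s -> A n x.
Proof.
move=> Ah; elim: s => [|y s IHs] sA; first by exists 0.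
have [|n nP] := IHs; first by move=> x xs; apply: sA; rewrite inE xs orbT.
have [k Ak] := sA y (mem_head _ _); exists (maxn n k) => x.
rewrite inE => /orP[/eqP->|/nP Anx].
  exact: chain_homo (leq_maxr n k) _ Ak.
exact: chain_homo (leq_maxl n k) _ Anx.
Qed.

Lemma submodule_chain V (A : nat -> set V) : (forall n, submodule (A n)) ->
  (forall n, A n `<=` A n.+1) -> submodule (\bigcup_n A n).
Proof.
move=> smA Ah; split=> [|a u v [n _ An] [k _ Ak]].
  by exists 0 => //; apply: submodule0.
exists (maxn n k) => //; apply: (smA _).2.
  exact: chain_homo (leq_maxl n k) _ An.
exact: chain_homo (leq_maxr n k) _ Ak.
Qed.

Lemma noetherian_chain (A : nat -> set R^o) : (forall n, submodule (A n)) ->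
  (forall n, A n `<=` A n.+1) -> exists n, forall k, A k `<=` A n.
Proof.
move=> smA Ah; have [s sE] := noetherian_ideal (submodule_chain smA Ah).
have [|n nP] := @chain_seq _ A s Ah.
  by move=> x /mem_lspan; rewrite sE => -[n _ An]; exists n.
exists n => k x Ax; apply: (lspan_sub (smA n) nP).
by rewrite sE; exists k.
Qed.

(* If z = c + r a^n x lies in B, then a^n z lies in U, so r annihilates
   a^(2n) x modulo K; once the ideals (K : a^n x) are stationary, r a^n x lies
   in K and z in U.  Hence K + R a^n x is not larger than K. *)
Lemma maximal_torsion V (B U K : set V) (a : R) :
    submodule K -> U `<=` K -> K `&` B `<=` U ->
    (forall K', submodule K' -> K `<=` K' -> K' `&` B `<=` U -> K' `<=` K) ->
    submodule B -> (forall x, B x -> U (a *: x)) ->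
  forall x, exists n, K (a ^+ n *: x).
Proof.
move=> smK UK KB Kmax smB aB x.
pose C n : set R^o := [set r | K (r *: (a ^+ n *: x))].
have [||n0 n0P] := @noetherian_chain C.
- move=> n; split=> [|b r r']; rewrite /C /=.
    by rewrite scale0r; apply: submodule0.
  by rewrite scalerDl -[(b *: r) *: _]scalerA; apply: smK.2.
- move=> n r; rewrite /C /= => /(submoduleZ smK a).
  by rewrite exprS !scalerA mulrCA mulrA.
(* One factor more than [n0], so that [a ^+ n] maps [B] into [K]. *)
pose n := n0.+1; exists n.
have aBn z : B z -> K (a ^+ n *: z).
  by move=> Bz; rewrite exprSr -scalerA; apply: submoduleZ => //; apply/UK/aB.
apply: (Kmax (addm K (lspan [:: a ^+ n *: x]))).
- exact: submodule_addm (submodule_lspan _).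
- exact: addm_subl (submodule_lspan _).
- move=> z [[c [_ [Kc /= [r [_ [-> ->]]] zE]]] Bz].
  rewrite addr0 in zE; apply: KB; split=> //; rewrite zE.
  apply: submoduleD => //.
  have: C (n + n)%N r.
    have := submoduleB smK (aBn z Bz) (submoduleZ smK (a ^+ n) Kc).
    rewrite zE scalerDr addrC addKr /C /=.
    by rewrite !scalerA exprD mulrA (mulrC r).
  by move/n0P/(submoduleZ smK a); rewrite /C /= /n exprS !scalerA mulrCA mulrA.
- by apply: addm_subr => //; apply: mem_lspan; rewrite mem_head.
Qed.

End Noetherian.

(** * Ideals, and units of a local ring *)

Lemma idealMl (R : comNzRingType) (J : ideal R) r c : c \in J -> r * c \in J.
Proof. exact: (submoduleZ (submodule_mem J) r). Qed.

Lemma idealD (R : comNzRingType) (J : ideal R) b c :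
  b \in J -> c \in J -> b + c \in J.
Proof. exact: (submoduleD (submodule_mem J)). Qed.

Section LocalRing.
Variables (R : comNzRingType) (m : ideal R).
Hypothesis localR : local_ring m.

Lemma local_1notin : 1 \notin m.
Proof. by case: localR => -[]. Qed.

(** If [a] were not a unit, an ideal maximal among those that contain [a] and avoid 1 would be a
    maximal ideal, hence equal to [m]. *)
Lemma local_unit a : a \notin m -> exists b, b * a = 1.
Proof.
move=> am; apply: contrapT => nu.
have [||K [smK aK K1 Kmax]] := @submodule_Zorn R R^o (lspan [:: a : R^o]) [set (1 : R)] set0.
- exact: submodule_lspan.
- move=> x [/= [b [_ [-> xE]]] x1]; apply: nu; exists b.
  by rewrite -[LHS](addr0 (b * a)) -[RHS]x1 xE.
have [S SE] := submodule_pred smK.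
case/negP: am; suff /localR.2 <- : maximal_ideal S.
  by apply/SE/aK/mem_lspan; rewrite mem_head.
split=> [|J J1 SJ x Jx]; first by apply/negP => /SE K1'; have := K1 1 (conj K1' erefl).
apply/SE; apply: (Kmax [set x | x \in J]) => //.
- exact: submodule_mem.
- by move=> y /SE/SJ.
- by move=> y [/= Jy y1]; rewrite y1 (negPf J1) in Jy.
Qed.

(** Plays the part of Nakayama's lemma for cyclic modules: a relation x = a x + y with [a] in [m]
    puts x in R y. *)
Lemma local_unitB a : a \in m -> exists b, b * (1 - a) = 1.
Proof.
move=> am; apply: local_unit; apply/negP => am1.
have /negP := local_1notin; apply; rewrite -(subrK a 1).
exact: idealD.
Qed.

End LocalRing.

(** Dependent choice in which each term may depend on the list of all earlier ones. *)
Lemma seq_choice T (P : seq T -> T -> Prop) : (forall s, exists y, P s y) ->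
  exists y : nat -> T, forall n, P (mkseq y n) (y n).
Proof.
move=> /choice[f fP].
pose s n := iter n (fun s => rcons s (f s)) [::].
exists (f \o s) => n; suff <- : s n = mkseq (f \o s) n by apply: fP.
by elim: n => // n IHn; rewrite mkseqS -IHn.
Qed.

(** * Finite-dimensional socles *)

Section FiniteSocles.
Variables (R : comNzRingType) (m : ideal R).
Hypotheses (noethR : noetherian R) (localR : local_ring m).
Implicit Types V W : lmodType R.

(* All the quotients V / U have finite-dimensional socles. *)
Definition fin_socles V : Prop :=
  forall U W : set V, submodule U -> submodule W -> U `<=` W ->
    (forall (a : R) x, a \in m -> W x -> U (a *: x)) ->
  exists2 s, (forall x, x \in s -> W x) & W `<=` addm U (lspan s).

Lemma lspan_mkseq V (y : nat -> V) n : lspan (mkseq y n) `<=` lspan (mkseq y n.+1).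
Proof. by apply: lspan_subseq => x; rewrite mkseqS mem_rcons inE orbC => ->. Qed.

Lemma mem_lspan_mkseq V (y : nat -> V) i n : (i < n)%N -> lspan (mkseq y n) (y i).
Proof. by move=> ltin; apply: mem_lspan; apply: map_f; rewrite mem_iota. Qed.

Lemma addm_mono V (U A B : set V) : A `<=` B -> addm U A `<=` addm U B.
Proof. by move=> AB _ [u [v [Uu Av ->]]]; exists u, v; split=> //; apply: AB. Qed.

(** Infinitely many socle elements of V / U cannot be independent: the module generated by [U] and
    all the [y n] is, modulo [U], killed by [m], hence generated by finitely many elements, which
    lie in some stage [A n]. *)
Lemma fin_socles_seq V (U : set V) (y : nat -> V) : fin_socles V ->
    submodule U -> (forall n (a : R), a \in m -> U (a *: y n)) ->
  exists n, addm U (lspan (mkseq y n)) (y n).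
Proof.
move=> finV smU Uy; pose A n := addm U (lspan (mkseq y n)).
have smA n : submodule (A n) by apply: submodule_addm (submodule_lspan _).
have Ah n : A n `<=` A n.+1 by apply: addm_mono; apply: lspan_mkseq.
have [||a x am [n _ [u [v [Uu yv ->]]]]|s sA As] := finV U (\bigcup_n A n) smU.
- exact: submodule_chain.
- by move=> x Ux; exists 0 => //; apply: addm_subl => //; apply: submodule_lspan.
- rewrite scalerDr; apply: submoduleD => //; first exact: submoduleZ.
  apply: (lspan_sub (submodule_colon a smU)) yv => z /mapP[i _ ->].
  exact: Uy.
have [n nP] : exists n, forall x, x \in s -> A n x.
  by apply: chain_seq => // x /sA[n _ An]; exists n.
exists n; have : addm U (lspan s) (y n).
  apply: As; exists n.+1 => //; apply: addm_subr => //.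
  exact: mem_lspan_mkseq.
apply: (addm_sub (smA n)); last exact: lspan_sub.
by apply: addm_subl; apply: submodule_lspan.
Qed.

Lemma lspan_rcons V (s : seq V) x v :
  lspan (rcons s x) v -> exists a w, lspan s w /\ v = a *: x + w.
Proof.
move=> sv; suff : lspan (x :: s) v by [].
by apply: lspan_subseq sv => y; rewrite mem_rcons.
Qed.

(** The generators of [m] are treated one after the other: the current multiple of [x] is multiplied
    by the last power of the generator that keeps it outside [U]. *)
Lemma socle_elt V (U : set V) x : submodule U -> ~ U x ->
    (forall a : R, a \in m -> exists k, U (a ^+ k *: x)) ->
  exists r, ~ U (r *: x) /\ forall a : R, a \in m -> U (a *: (r *: x)).
Proof.
move=> smU nUx torx.
have [s sm] : exists s : seq R, lspan (V := R^o) s = [set x | x \in m].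
  exact: noetherian_ideal noethR _ (submodule_mem m).
have [r [nUr rP]] : exists r, ~ U (r *: x) /\ forall a : R, a \in s -> U (a *: (r *: x)).
  have : forall a : R, a \in s -> exists k, U (a ^+ k *: x).
    by move=> a /(mem_lspan (V := R^o)); rewrite sm => /torx.
  elim: {sm} s => [|a s IHs] tors; first by exists 1; rewrite scale1r.
  have [|r [nUr rP]] := IHs; first by move=> b bs; apply: tors; rewrite inE bs orbT.
  have exk : exists k, `[< U (a ^+ k *: (r *: x)) >].
    have [k Uk] := tors a (mem_head _ _); exists k; apply/asboolP.
    by rewrite scalerA mulrC -scalerA; apply: submoduleZ.
  case: (ex_minnP exk) => -[|k] /asboolP Uk mink.
    by rewrite scale1r in Uk.
  exists (a ^+ k * r); split.
    by rewrite -scalerA => /asboolP/mink; rewrite ltnn.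
  move=> b; rewrite inE -[(_ * r) *: x]scalerA => /orP[/eqP->|/rP].
    by rewrite [a *: _]scalerA -exprS.
  by rewrite [b *: (_ *: (_ *: _))]scalerA mulrC -scalerA; apply: submoduleZ.
exists r; split=> // a am.
have : [set x | x \in m] a by []. rewrite -sm => sa.
apply: (lspan_sub (V := R^o) (A := [set a : R^o | U (a *: (r *: x))])) sa => //.
split=> [|b c d]; rewrite /= ?scale0r; first exact: submodule0.
by rewrite scalerDl -[(b *: c) *: _]scalerA; apply: smU.2.
Qed.

(** Let [U] be the intersection of the chain. Some [S n] contains no nonzero socle element of V / U,
    by [fin_socles_seq]; as V / U is m-torsion, [socle_elt] then forces [S n] into [U]. *)
Lemma fin_socles_artinian V (S : nat -> set V) : fin_socles V ->
    (forall n, submodule (S n)) -> (forall n, S n.+1 `<=` S n) ->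
    (forall (a : R) x, a \in m -> exists k, forall n, S n (a ^+ k *: x)) ->
  exists n, forall k, S n `<=` S k.
Proof.
move=> finV smS Sh tor.
have Santi n k : (n <= k)%N -> S k `<=` S n.
  by move=> /subnK <-; elim: (k - n)%N => // j IHj x /Sh/IHj.
pose U : set V := [set x | forall n, S n x].
have smU : submodule U.
  by split=> [n|a u v Uu Uv n]; [apply: submodule0|apply: (smS n).2].
have [n nP] : exists n, forall x, S n x -> (forall a : R, a \in m -> U (a *: x)) -> U x.
  apply: contrapT => noex.
  have /choice[f fP] n : exists p : V * nat, [/\ S n p.1, ~ S p.2 p.1 &
      forall a : R, a \in m -> U (a *: p.1)].
    apply: contrapT => nop; apply: noex; exists n => x Sx Ux k.
    by apply: contrapT => nSx; apply: nop; exists (x, k).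
  (* The indices are chosen so that the socle element [y j] lies in [S (N j)] but no longer in
     [S (N j.+1)]. *)
  pose N j := iter j (fun n => (f n).2) 0%N.
  pose y j := (f (N j)).1.
  have SNy j : S (N j) (y j) by case: (fP (N j)).
  have nSNy j : ~ S (N j.+1) (y j) by case: (fP (N j)).
  have Uy j a : a \in m -> U (a *: y j) by case: (fP (N j)) => _ _; apply.
  have NS j : (N j <= N j.+1)%N.
    rewrite leqNgt; apply/negP => /ltnW/Santi/(_ _ (SNy j)); exact: nSNy.
  have Nm i j : (i <= j)%N -> (N i <= N j)%N.
    by move=> /subnK <-; elim: (j - i)%N => // k /leq_trans; apply.
  have [j [u [b [Uu bj yE]]]] := fin_socles_seq finV smU Uy.
  (* In such a relation every term except that of [y i] lies in [S (N i.+1)]. If the coefficient of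
     [y i] is in [m], its term is absorbed into [u]; otherwise it is a unit and [y i] would lie in
     [S (N i.+1)]. *)
  suff absurd l : forall i u b, U u -> lspan (map y (iota i l)) b ->
      y (i + l)%N = u + b -> False by exact: absurd Uu bj yE.
  elim: l => [|l IHl] i {Uu yE}u {bj}b Uu.
    by rewrite addn0 /= => ->; rewrite addr0 => yiE; apply: (nSNy i); rewrite yiE.
  move=> /= [a [w [bw ->]]] yE.
  have Sw : S (N i.+1) w.
    apply: (lspan_sub (smS _)) bw => _ /mapP[k + ->].
    by rewrite mem_iota => /andP[/Nm/Santi + _]; apply.
  have Say : S (N i.+1) (a *: y i).
    have -> : a *: y i = y (i + l.+1)%N - u - w.
      by rewrite yE [u + _]addrC !addrK.
    apply: submoduleB => //; apply: submoduleB => //.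
    by apply: Santi (SNy _); apply: Nm; rewrite addnS ltnS leq_addr.
  have [am|/(local_unit localR)[c ca1]] := boolP (a \in m).
    apply: (IHl i.+1 (u + a *: y i) w) => //; last by rewrite addSnnS yE addrA.
    by apply: (submoduleD smU) => //; apply: Uy.
  apply: (nSNy i); have -> : y i = c *: (a *: y i) by rewrite scalerA ca1 scale1r.
  exact: (submoduleZ (smS _)).
exists n => k x Sx; suff : U x by apply.
apply: contrapT => nUx.
have [a am|r [nUr rP]] := socle_elt smU nUx.
  by have [j jP] := tor a x am; exists j.
by apply: nUr; apply: nP => //; apply: submoduleZ.
Qed.

(** If W / U were infinite-dimensional over R/m, it would contain independent elements y_0, y_1, ...
    The cosets [C n] of [T n] = U + <y_i | i >= n> through the partial sums [s n] decrease, so they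
    have a common point [x], a formal sum of all the y_i; but [x] lies in [T 0] and involves
    finitely many of them. *)
Lemma compact_fin_socles V :
    (forall F : set (set V),
       (forall C, F C -> exists S x, submodule S /\ C = [set y | S (y - x)]) ->
       finI F id -> \bigcap_(C in F) C !=set0) ->
  fin_socles V.
Proof.
move=> cptV U W smU smW UW mW; apply: contrapT => nfin.
have [s|y yP] := @seq_choice V (fun s y => (forall x, x \in s -> W x) ->
    W y /\ ~ addm U (lspan s) y).
  (* For a list not contained in [W] the condition is void, and 0 is a default value. *)
  have [sW|nsW] := pselect (forall x, x \in s -> W x); last by exists 0.
  apply: contrapT => noy; apply: nfin; exists s => // x Wx.
  by apply: contrapT => nx; apply: noy; exists x => _.
have Wy n : W (y n).
  have [k] := ubnP n; elim: k n => // k IHk n ltnk.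
  suff /yP[] : forall x, x \in mkseq y n -> W x by [].
  move=> _ /mapP[i + ->]; rewrite mem_iota => /= ltin.
  by apply: IHk; apply: leq_trans ltin _.
have ny n : ~ addm U (lspan (mkseq y n)) (y n).
  by have [|//] := yP n; move=> _ /mapP[i _ ->].
have Uy n a : a \in m -> U (a *: y n) by move=> am; apply: mW.
pose A n k := addm U (lspan (map y (iota n k))).
have smA n k : submodule (A n k) by apply: submodule_addm (submodule_lspan _).
have Ah n k : A n k `<=` A n k.+1.
  apply: addm_mono; apply: lspan_subseq => _ /mapP[i + ->]; rewrite mem_iota => ik.
  apply: map_f; rewrite mem_iota addnS ltnS; case/andP: ik => -> /ltnW; exact.
pose T n := \bigcup_k A n k.
have smT n : submodule (T n) by apply: submodule_chain.
have TS n : T n.+1 `<=` T n.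
  move=> x [k _ Ax]; exists k.+1 => //; apply: addm_mono Ax.
  by apply: lspan_subseq => _ /mapP[i ii ->]; apply: map_f; rewrite /= inE ii orbT.
have Ty n : T n (y n).
  by exists 1 => //; apply: addm_subr => //; apply: mem_lspan; rewrite mem_head.
pose s n := \sum_(i < n) y i.
pose C n := [set x | T n (x - s n)].
have CS n : C n.+1 `<=` C n.
  move=> x /TS; rewrite /C /s big_ord_recr /= opprD addrA.
  by apply: submodule_subl.
have Cm i j : (i <= j)%N -> C j `<=` C i.
  by move=> /subnK <-; elim: (j - i)%N => // k IHk x /CS/IHk.
have [||x xP] := cptV (range C).
- by move=> _ [n _ <-]; exists (T n), (s n).
- move=> D DF; have [n nP] : exists n, forall B, B \in enum_fset D -> C n `<=` B.
    have : forall B, B \in enum_fset D -> exists n, C n `<=` B.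
      by move=> B /DF; rewrite inE => -[n _ <-]; exists n.
    elim: (enum_fset D) => [|B l IHl] lP; first by exists 0.
    have [|i iP] := IHl; first by move=> B' lB'; apply: lP; rewrite inE lB' orbT.
    have [j jP] := lP B (mem_head _ _); exists (maxn i j) => B'.
    rewrite inE => /orP[/eqP->|/iP CB] z Cz.
      by apply: jP; apply: Cm Cz; apply: leq_maxr.
    by apply: CB; apply: Cm Cz; apply: leq_maxl.
  exists (s n) => B /nP; apply; rewrite /C /= subrr; exact: submodule0.
have /= Cx n : C n x by apply: xP; exists n.
have := Cx 0%N; rewrite /C /= /s big_ord0 subr0 => -[k _ Ax].
have := Cx k.+1; rewrite /C /s big_ord_recr /= => -[j _ Aj].
pose Z := addm U (lspan (mkseq y k)).
have smZ : submodule Z by apply: submodule_addm (submodule_lspan _).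
have UZ : U `<=` Z by apply: addm_subl; apply: submodule_lspan.
(* Two descriptions of [x] are compared: it lies in [Z], and [x - s k - y k] lies in [T k.+1]. *)
have {Aj} : addm Z (lspan (map y (iota k.+1 j))) (y k).
  have [u [v [Uu jv xE]]] := Aj.
  exists (x - s k - u), (- v); split.
  - apply: submoduleB => //; last exact: UZ.
    apply: submoduleB => //; apply: addm_subr => //.
    rewrite /s; elim/big_ind: _ => [||i _]; [apply: submodule0|apply: submoduleD|].
    + exact: submodule_lspan.
    + exact: submodule_lspan.
    + exact: mem_lspan_mkseq.
  - by apply: submoduleN => //; apply: submodule_lspan.
  - rewrite -[RHS]addrA -opprD -xE /s opprB !addrA subrK.
    by rewrite [x + _]addrC addrK.
(* The last term is removed: with coefficient in [m] it lies in [U], and with unit coefficient it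
   would express [y (k.+1 + j)] by [U] and earlier terms. *)
elim: j => [[z [_ [Zz -> yE]]]|j IHj]; first by apply: (ny k); rewrite yE addr0.
rewrite -[j.+1]addn1 iotaD map_cat cats1 => -[z [_ [Zz /lspan_rcons[a [w [jw ->]]] yE]]].
have [am|/(local_unit localR)[c ca1]] := boolP (a \in m).
  apply: IHj; exists (z + a *: y (k.+1 + j)%N), w; split=> //; last by rewrite yE addrA.
  by apply: submoduleD => //; apply/UZ/Uy.
apply: (ny (k.+1 + j)%N); set y' := y _.
have smB : submodule (addm U (lspan (mkseq y (k.+1 + j)))).
  by apply: submodule_addm (submodule_lspan _).
have -> : y' = c *: (y k - z - w).
  by rewrite yE [z + _]addrC !addrK scalerA ca1 scale1r.
apply: submoduleZ => //; apply: submoduleB => //; first apply: submoduleB => //.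
- by apply: addm_subr => //; apply: mem_lspan_mkseq; rewrite addSn ltnS leq_addr.
- apply: addm_mono Zz; apply: lspan_subseq => _ /mapP[i + ->].
  rewrite mem_iota => /= ltik; apply: map_f; rewrite mem_iota /= addSn ltnS.
  exact: leq_trans (ltnW ltik) (leq_addr _ _).
- apply: addm_subr => //; apply: lspan_subseq jw => _ /mapP[i + ->].
  by rewrite mem_iota => /andP[_ ltik]; apply: map_f; rewrite mem_iota.
Qed.

End FiniteSocles.

(** * Serre classes *)

Section SerreClasses.
Variable R : comNzRingType.
Implicit Types A B D T : lmodType R.

(* Exactness of A -> B -> D at the middle only: for A = 0 or D = 0 this covers
   submodules and quotients. *)
Definition serre_class (C : lmodType R -> Prop) : Prop :=
  (forall T, (forall x : T, x = 0) -> C T) /\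
  forall A B D (f : {linear A -> B}) (g : {linear B -> D}),
    (forall y, g y = 0 -> exists x, f x = y) -> C A -> C D -> C B.

Section Closure.
Variable C : lmodType R -> Prop.
Hypothesis serreC : serre_class C.

Lemma serre_inj A B (f : {linear A -> B}) : injective f -> C B -> C A.
Proof.
move=> injf; apply: (serreC.2 _ _ _ (\0 : {linear 'rV[R]_0 -> A}) f).
  by move=> y fy0; exists 0; apply: injf; rewrite fy0 /= linear0.
by apply: serreC.1 => x; apply: thinmx0.
Qed.

Lemma serre_surj A B (f : {linear A -> B}) :
  (forall y, exists x, f x = y) -> C A -> C B.
Proof.
move=> surjf CA; apply: (serreC.2 _ _ _ f (\0 : {linear B -> 'rV[R]_0})) CA _.
  by move=> y _; apply: surjf.
by apply: serreC.1 => x; apply: thinmx0.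
Qed.

Lemma serre_ffun T n : C T -> C {ffun 'I_n -> T}.
Proof.
move=> CT; elim: n => [|n IHn].
  by apply: serreC.1 => x; apply/ffunP => -[].
pose f (x : T) : {ffun 'I_n.+1 -> T} := [ffun i => if i == ord0 then x else 0].
pose g (u : {ffun 'I_n.+1 -> T}) : {ffun 'I_n -> T} := [ffun i => u (lift ord0 i)].
have f_lin : linear f.
  by move=> a x y; apply/ffunP => i; rewrite !ffunE; case: ifP; rewrite // scaler0 addr0.
have g_lin : linear g by move=> a x y; apply/ffunP => i; rewrite !ffunE.
pose fB := GRing.isLinear.Build R _ _ _ f f_lin.
pose gB := GRing.isLinear.Build R _ _ _ g g_lin.
pose fL : {linear T -> {ffun 'I_n.+1 -> T}} := HB.pack f fB.
pose gL : {linear {ffun 'I_n.+1 -> T} -> {ffun 'I_n -> T}} := HB.pack g gB.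
apply: (serreC.2 _ _ _ fL gL) => // u /ffunP gu.
exists (u ord0); apply/ffunP => i; rewrite /= !ffunE.
case: ifP => [/eqP->//|]; case: (unliftP ord0 i) => [j ->|->]; last by rewrite eqxx.
by have := gu j; rewrite !ffunE.
Qed.

End Closure.

(** Generators of W / U are obtained from lifts of generators of g(W) modulo g(U) and images of
    generators of f^-1(W) modulo f^-1(U). *)
Lemma fin_socles_serre (m : ideal R) : serre_class (fin_socles m).
Proof.
split=> [T T0 U W smU smW UW mW|A B D f g fg finA finD U W smU smW UW mW].
  exists [::] => // x Wx; exists 0, 0; split=> //; first exact: submodule0.
  by rewrite addr0.
have [||||s'' s''W Ws''] := finD (g @` U) (g @` W).
- exact: submodule_image.
- exact: submodule_image.
- by move=> _ [x /UW Wx <-]; exists x.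
- by move=> a _ am [x Wx <-]; exists (a *: x); [apply: mW|rewrite linearZ].
have [s sW gs] := image_map s''W.
have [||||s' s'W Ws'] := finA (f @^-1` U) (f @^-1` W).
- exact: submodule_preim.
- exact: submodule_preim.
- by move=> x /UW.
- by move=> a x am Wx; rewrite /preimage /= linearZ; apply: mW.
exists (s ++ map f s') => [x|w Ww].
  by rewrite mem_cat => /orP[/sW//|/mapP[y /s'W Wy ->]].
have [|_ [gv [[u Uu <-] + gwE]]] := Ws'' (g w); first by exists w.
rewrite -gs lspan_map => -[v sv gvE]; rewrite -{gv}gvE in gwE.
have Wv : W v by apply: (lspan_sub smW) sv.
have [|x fx] := fg (w - u - v); first by rewrite !linearB /= gwE -addrA -opprD subrr.
have Wx : (f @^-1` W) x.
  by rewrite /preimage /= fx; apply: submoduleB => //; apply: submoduleB => //; apply: UW.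
have [x1 [x2 [Ux1 s'x2 xE]]] : addm (f @^-1` U) (lspan s') x by apply: Ws'.
exists (u + f x1), (v + f x2); split.
- exact: submoduleD.
- apply: submoduleD; first exact: submodule_lspan.
    by apply: lspan_subseq sv => y ys; rewrite mem_cat ys.
  apply: (@lspan_subseq _ _ (map f s')) => [y ys|]; first by rewrite mem_cat ys orbT.
  by rewrite lspan_map; exists x2.
- rewrite addrACA -linearD -xE fx -[w - u - v]addrA -opprD.
  by rewrite addrC subrK.
Qed.

(* Supp (R x / I x) is contained in {m} for all x. *)
Definition torsion_mod (m I : ideal R) T : Prop :=
  forall (x : T) (a : R), a \in m -> exists k (c : R), c \in I /\ (a ^+ k - c) *: x = 0.

(** The product (a^l - d)(a^k - c) of the annihilating elements found in [A] and [D] is again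
    a^(l+k) minus an element of [I]. *)
Lemma torsion_mod_serre m I : serre_class (torsion_mod m I).
Proof.
split=> [T T0 x a am|A B D f g fg torA torD x a am].
  by exists 0%N, 0; split; rewrite ?(T0 x) ?scaler0 //; apply: (rpred0 I).
have [k [c [cI gx]]] := torD (g x) a am.
have [|y fy] := fg ((a ^+ k - c) *: x); first by rewrite linearZ.
have [l [d [dI yE]]] := torA y a am.
exists (l + k)%N, (a ^+ l * c + d * (a ^+ k - c)); split.
  by apply: idealD; [|rewrite mulrC]; apply: idealMl.
have := congr1 f yE; rewrite linear0 linearZ /= fy scalerA => <-.
by congr (_ *: x); rewrite exprD opprD addrA -mulrBr mulrBl.
Qed.

Definition power_fg (b : R) T : Prop := exists n s, forall x : T, lspan s (b ^+ n *: x).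

(** The part of <s''> inside the image of [g] is finitely generated, so its generators lift to [B].
    Up to the module they generate, [b ^+ n'' *: x] comes from some [y] in [A], and [b ^+ n'] takes
    care of [y]. *)
Lemma power_fg_serre (noethR : noetherian R) b : serre_class (power_fg b).
Proof.
split=> [T T0|A B D f g fg [n' [s' s'P]] [n'' [s'' s''P]]].
  by exists 0%N, [::] => x; rewrite (T0 x) scaler0.
have [||t tE] := @noetherian_sub _ noethR _ s'' (lspan s'' `&` (g @` [set: B])).
- by apply: submoduleI; [apply: submodule_lspan | apply: submodule_image].
- by move=> y [].
have [|s _ sE] := @image_map _ _ _ g setT t.
  by move=> y /mem_lspan; rewrite tE => -[].
exists (n' + n'')%N, (map f s' ++ map (fun v => b ^+ n' *: v) s) => x.
have : lspan t (g (b ^+ n'' *: x)).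
  by rewrite tE; split; [rewrite linearZ; apply: s''P | exists (b ^+ n'' *: x)].
rewrite -sE lspan_map => -[v sv gv].
have [|y fy] := fg (b ^+ n'' *: x - v); first by rewrite linearB /= gv subrr.
have -> : b ^+ (n' + n'') *: x = f (b ^+ n' *: y) + b ^+ n' *: v.
  by rewrite linearZ /= fy -scalerDr subrK scalerA exprD.
apply: submoduleD; first exact: submodule_lspan.
  apply: (@lspan_subseq _ _ (map f s')) => [z zs|]; first by rewrite mem_cat zs.
  by rewrite lspan_map; exists (b ^+ n' *: y).
have smb := submodule_colon (b ^+ n')
  (submodule_lspan (map f s' ++ map (fun v => b ^+ n' *: v) s)).
apply: (lspan_sub smb) sv => z zs; apply: mem_lspan.
by rewrite mem_cat; apply/orP; right; apply: map_f.
Qed.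

Lemma trivial_serre : serre_class (fun T => forall x : T, x = 0).
Proof.
split=> // A B D f g fg A0 D0 x.
by have [|y <-] := fg x; [rewrite (D0 (g x)) | rewrite (A0 y) linear0].
Qed.

End SerreClasses.

(** * The product of an ideal and a submodule *)

Section IdealTimesSubmodule.
Variables (R : comNzRingType) (J : ideal R).
Implicit Types V : lmodType R.

Definition imul V (A : set V) : set V :=
  [set x | forall S, submodule S ->
     (forall (c : R) y, c \in J -> A y -> S (c *: y)) -> S x].

Lemma submodule_imul V (A : set V) : submodule (imul A).
Proof.
split=> [S smS _|a u v Ju Jv S smS SA]; first exact: submodule0.
by apply: smS.2; [apply: Ju|apply: Jv].
Qed.

Lemma mem_imul V (A : set V) (c : R) y : c \in J -> A y -> imul A (c *: y).
Proof. by move=> cJ Ay S smS; apply. Qed.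

Lemma imul_sub V (A : set V) : submodule A -> imul A `<=` A.
Proof. by move=> smA x; apply=> // c y _; apply: submoduleZ. Qed.

Lemma imul_mono V (A B : set V) : A `<=` B -> imul A `<=` imul B.
Proof.
move=> AB x; apply; first exact: submodule_imul.
by move=> c y cJ /AB; apply: mem_imul.
Qed.

Lemma imul_rcons V (s : seq V) x y : imul (lspan (rcons s x)) y ->
  exists (c : R) v, [/\ c \in J, imul (lspan s) v & y = c *: x + v].
Proof.
move=> Jy; apply: (Jy [set y | exists (c : R) v,
    [/\ c \in J, imul (lspan s) v & y = c *: x + v]]) => {Jy}.
  split=> [|a u v [c [u' [cJ su ->]]] [d [v' [dJ sv ->]]]].
    exists 0, 0; split; rewrite ?scale0r ?addr0 //; first exact: (rpred0 J).
    exact: submodule0 (submodule_imul _).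
  exists (a * c + d), (a *: u' + v'); split.
  - by apply: idealD => //; apply: idealMl.
  - exact: (submodule_imul _).2.
  - by rewrite scalerDr scalerA scalerDl addrACA.
move=> c z cJ /lspan_rcons[a [v [sv ->]]]; exists (c * a), (c *: v); split.
- by rewrite mulrC; apply: idealMl.
- exact: mem_imul.
- by rewrite scalerDr scalerA.
Qed.

Lemma imul_line V (x y : V) : imul (lspan [:: x]) y -> exists2 c : R, c \in J & y = c *: x.
Proof.
move=> /(@imul_rcons _ [::])[c [v [cJ /(imul_sub (submodule_lspan _)) v0 ->]]].
by exists c => //; rewrite v0 addr0.
Qed.

(** Contains [imul J A] as soon as the list generates [J]; the explicit sum allows induction on the
    generators of the ideal. *)
Fixpoint lmul V (bs : seq R) (A : set V) : set V :=
  if bs is b :: bs' then addm [set b *: x | x in A] (lmul bs' A) else [set 0].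

Lemma submodule_scale V b (A : set V) : submodule A -> submodule [set b *: x | x in A].
Proof.
move=> smA; split=> [|a _ _ [u Au <-] [v Av <-]].
  by exists 0; rewrite ?scaler0 //; apply: submodule0.
exists (a *: u + v); first exact: smA.2.
by rewrite scalerDr !scalerA mulrC.
Qed.

Lemma submodule_lmul V bs (A : set V) : submodule A -> submodule (lmul bs A).
Proof.
move=> smA; elim: bs => [|b bs IHbs]; first exact: submodule_set0.
by apply: submodule_addm; first exact: submodule_scale.
Qed.

Lemma mem_lmul V bs (A : set V) b x : submodule A ->
  b \in bs -> A x -> lmul bs A (b *: x).
Proof.
move=> smA + Ax; elim: bs => //= b' bs IHbs; rewrite inE => /orP[/eqP<-|/IHbs].
  by apply: addm_subl; [apply: submodule_lmul | exists x].
by apply: addm_subr; apply: submodule_scale.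
Qed.

Lemma imul_lmul V (bs : seq R) (A : set V) : submodule A ->
  lspan (V := R^o) bs = [set c | c \in J] -> imul A `<=` lmul bs A.
Proof.
move=> smA bsJ x; apply; first exact: submodule_lmul.
move=> c y cJ Ay; have : [set c | c \in J] c by []. rewrite -bsJ => bsc.
apply: (lspan_sub (V := R^o) (A := [set c : R^o | lmul bs A (c *: y)])) bsc.
  split=> [|a u v]; rewrite /= ?scale0r.
    by apply: submodule0; apply: submodule_lmul.
  by rewrite scalerDl -[(a *: u) *: _]scalerA; apply: (submodule_lmul _ smA).2.
by move=> b bbs; apply: mem_lmul.
Qed.

End IdealTimesSubmodule.

(** * Modules that are m-torsion modulo a finitely generated submodule *)

Section Minimax.
Variables (R : comNzRingType) (m : ideal R).
Hypotheses (noethR : noetherian R) (localR : local_ring m).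
Implicit Types V W : lmodType R.

(* If V / <s> is never m-torsion, one gets y_0, y_1, ... such that y_n is not in
   B_n = <y_i | i < n> and m y_n `&` B_n `<=` m B_n; the images of the y_n in the
   quotient by the union of the m B_n are then independent socle elements. *)
Lemma fin_socles_minimax V : fin_socles m V ->
  exists s : seq V, forall (a : R) x, a \in m -> exists k, lspan s (a ^+ k *: x).
Proof.
move=> finV; apply: contrapT => nofg.
have [s|y yP] := @seq_choice V (fun s y => ~ lspan s y /\
    forall c : R, c \in m -> lspan s (c *: y) -> imul m (lspan s) (c *: y)).
  have [a [x [am nsx]]] : exists (a : R) x, a \in m /\ forall k, ~ lspan s (a ^+ k *: x).
    apply: contrapT => noax; apply: nofg; exists s => a x am.
    apply: contrapT => nok; apply: noax; exists a, x; split=> // k sk.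
    by apply: nok; exists k.
  have sms := submodule_lspan s; have smms := submodule_imul m (lspan s).
  (* Since [K] meets <s> only inside m <s>, any element of [K] outside <s> can be the next term;
     [maximal_torsion] supplies one of the form [a ^+ n *: x]. *)
  have [|K [smK msK KB Kmax]] := submodule_Zorn (X := lspan s) (Y := imul m (lspan s)) smms.
    by move=> z [].
  have [|n Kn] := maximal_torsion noethR (a := a) smK msK KB Kmax sms _ x.
    by move=> z sz; apply: mem_imul.
  exists (a ^+ n *: x); split=> // c cm sc; apply: KB; split=> //.
  exact: submoduleZ.
pose B n := lspan (mkseq y n).
have smB n : submodule (B n) by apply: submodule_lspan.
have smmB n : submodule (imul m (B n)) by apply: submodule_imul.
have BS n : B n `<=` B n.+1 by apply: lspan_mkseq.
have mBS n : imul m (B n) `<=` imul m (B n.+1) by apply: imul_mono; apply: BS.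
have mBrcons n z : imul m (B n.+1) z ->
    exists (c : R) v, [/\ c \in m, imul m (B n) v & z = c *: y n + v].
  by rewrite /B mkseqS; apply: imul_rcons.
(* The elements of m B_(i+j) that lie in B_i already lie in m B_i: the term of the last [y] falls
   into the smaller span, where the choice of [y] applies. *)
have descent i j z : imul m (B (i + j)%N) z -> B i z -> imul m (B i) z.
  elim: j z => [|j IHj] z; first by rewrite addn0.
  rewrite addnS => /mBrcons[c [v [cm mBv zE]]] Bz; apply: IHj => //.
  rewrite zE; apply: (submoduleD (smmB _)) => //; apply: (yP _).2 => //.
  apply: (submodule_subl (submodule_lspan _) (v := - v)).
    exact: (submoduleN (smB _) (imul_sub (smB _) mBv)).
  rewrite opprK -zE; apply: (chain_homo BS (leq_addr j i)) Bz.
have [||n [u [b [[k _ mBu] Bb yE]]]] :=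
    fin_socles_seq (U := \bigcup_n imul m (B n)) (y := y) finV.
- exact: submodule_chain.
- by move=> n a am; exists n.+1 => //; apply: mem_imul => //; apply: mem_lspan_mkseq.
have Bu : B n.+1 u.
  have -> : u = y n - b by rewrite yE addrK.
  by apply: submoduleB => //; [apply: mem_lspan_mkseq|apply: BS].
have {k}mBu : imul m (B n.+1) u.
  apply: (descent _ k) Bu; apply: (chain_homo mBS) mBu; exact: leq_addl.
have [c [v [cm mBv uE]]] := mBrcons _ _ mBu.
(* Here y_n = u + b with u = c y_n + v, so (1 - c) y_n lies in B_n, and hence so does y_n. *)
have [d dc] := local_unitB localR cm.
apply: (yP n).1; have -> : y n = d *: (v + b).
  have -> : v + b = (1 - c) *: y n.
    by rewrite scalerBl scale1r {1}yE uE -!addrA [RHS]addrC !addrA subrK.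
  by rewrite scalerA dc scale1r.
apply: submoduleZ (smB n) _ _ _; apply: submoduleD => //; exact: (imul_sub (smB _) mBv).
Qed.

(** The generators [b] are eliminated one at a time. A single [n] has b^n <s> inside [Y]; applying
    the hypothesis [n] times turns the contribution of [b] into one of b^n, which [Y] absorbs. *)
Lemma torsion_nilpotent V (s : seq V) (Y : set V) a (bs : seq R) :
    submodule Y ->
    (forall v, lspan s v -> exists k, addm (lmul bs (lspan s)) Y (a ^+ k *: v)) ->
    (forall b v, b \in bs -> exists n, Y (b ^+ n *: v)) ->
  forall v, lspan s v -> exists k, Y (a ^+ k *: v).
Proof.
move=> smY; have sms := submodule_lspan s.
elim: bs => [|b bs IHbs] tora torb v sv.
  have [k [_ [w [-> Yw kE]]]] := tora v sv; exists k.
  by rewrite kE add0r.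
have smL := submodule_lmul bs sms.
apply: IHbs sv => [{}v sv|c w cbs]; last by apply: torb; rewrite inE cbs orbT.
have [n nP] : exists n, forall x, x \in s -> Y (b ^+ n *: x).
  apply: (@chain_seq _ (fun n => colon (b ^+ n) Y)) => [n x|x xs].
    by rewrite /colon /= exprS -scalerA; apply: submoduleZ.
  by apply: torb; rewrite mem_head.
have [k [v' [w [y [sv' Lw Yy kE]]]]] : exists k v' w y,
    [/\ lspan s v', lmul bs (lspan s) w, Y y & a ^+ k *: v = b ^+ n *: v' + w + y].
  elim: (n) => [|i [k [v' [w [y [sv' Lw Yy kE]]]]]].
    exists 0%N, v, 0, 0; split=> //; rewrite ?addr0 //; exact: submodule0.
  have [l [u [y' [[_ [w' [[v'' sv'' <-] Lw' ->]]] Yy' lE]]]] := tora v' sv'.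
  exists (l + k)%N, v'', (b ^+ i *: w' + a ^+ l *: w), (b ^+ i *: y' + a ^+ l *: y).
  split=> //.
  - by apply: submoduleD => //; apply: submoduleZ.
  - by apply: submoduleD => //; apply: submoduleZ.
  rewrite exprD -scalerA kE 2!scalerDr [a ^+ l *: (_ *: _)]scalerA mulrC -scalerA.
  by rewrite lE 2!scalerDr scalerA -exprSr !addrA; congr (_ + _); rewrite addrAC.
exists k, w, (b ^+ n *: v' + y); split=> //; last by rewrite kE addrA [w + _]addrC.
apply: submoduleD => //.
exact: (lspan_sub (submodule_colon (b ^+ n) smY)) sv'.
Qed.

(** After multiplication by a power of [a], [x] becomes some [x0] in <s>. Let [K] be maximal with
    [K] [&] R x0 inside I x0. Each element of [I] is nilpotent modulo [K] on every element, and <s>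
    / I <s> is a-torsion, so some a^k x0 lies in [K], hence in I x0. *)
Lemma minimax_torsion_mod (I : ideal R) V (s : seq V) :
    (forall (a : R) x, a \in m -> exists k, lspan s (a ^+ k *: x)) ->
    (forall (a : R) x, a \in m -> exists k, imul I [set: V] (a ^+ k *: x)) ->
  torsion_mod m I V.
Proof.
move=> tors torI x a am; have sms := submodule_lspan s.
have torIs v : exists k, imul I (lspan s) (a ^+ k *: v).
  have [k Ik] := torI a v am.
  have smD : submodule [set w | exists k, imul I (lspan s) (a ^+ k *: w)].
    have smI := submodule_imul I (lspan s).
    split=> [|r u w [i iu] [j jw]].
      by exists 0%N; rewrite scaler0; apply: submodule0.
    exists (i + j)%N; rewrite scalerDr; apply: (submoduleD smI); last first.
      by rewrite exprD -scalerA; apply: (submoduleZ smI).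
    have -> : a ^+ (i + j) *: (r *: u) = (r * a ^+ j) *: (a ^+ i *: u).
      by rewrite !scalerA exprD mulrC [a ^+ i * _]mulrC mulrA.
    exact: (submoduleZ smI).
  have [|j jP] := Ik _ smD.
    move=> c y cI _; have [j sj] := tors a y am; exists j.
    by rewrite scalerA mulrC -scalerA; apply: mem_imul.
  by exists (j + k)%N; rewrite exprD -scalerA.
have [k0 sx0] := tors a x am; set x0 := a ^+ k0 *: x in sx0.
have smIx := submodule_imul I (lspan [:: x0]).
have [|K [smK IxK KB Kmax]] :=
    submodule_Zorn (X := lspan [:: x0]) (Y := imul I (lspan [:: x0])) smIx.
  by move=> z [].
have torK b z : b \in I -> exists n, K (b ^+ n *: z).
  move=> bI; apply: (maximal_torsion noethR smK IxK KB Kmax (submodule_lspan _)).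
  by move=> w xw; apply: mem_imul.
have [bs bsI] : exists bs : seq R, lspan (V := R^o) bs = [set c | c \in I].
  exact: noetherian_ideal noethR _ (submodule_mem I).
have [|b v bbs|k Kk] := torsion_nilpotent (a := a) (bs := bs) smK _ _ sx0.
- move=> v sv; have [k Ik] := torIs v; exists k.
  by apply: addm_subl => //; apply: imul_lmul Ik.
- apply: torK; have : lspan (V := R^o) bs b by apply: mem_lspan.
  by rewrite bsI.
have [|c cI cE] := @imul_line _ I _ x0 (a ^+ k *: x0).
  apply: KB; split=> //; apply: submoduleZ; first exact: submodule_lspan.
  by apply: mem_lspan; rewrite mem_head.
exists (k + k0)%N, (a ^+ k0 * c); split; first exact: idealMl.
rewrite exprD [a ^+ k0 * c]mulrC -mulrBl -scalerA -/x0 scalerBl cE.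
by rewrite subrr.
Qed.

End Minimax.

Lemma quotmod_annihilated (R : comNzRingType) (J : ideal R) (a : R) (q : quotmod J) :
  a \in J -> a *: q = 0.
Proof.
move=> aJ; rewrite -(quot_piK q) -linearZ -[RHS](linear0 (quot_pi J)).
apply/eqP; rewrite quot_piE subr0 /GRing.scale /= mulrC.
exact: idealMl.
Qed.

(** * Cosupport and cocyclic quotients *)

Section Cosupport.
Variables (R : comNzRingType) (m : ideal R).
Hypotheses (noethR : noetherian R) (localR : local_ring m).
Implicit Types V W L E : lmodType R.

(** An ideal maximal among those that contain [J] and avoid the powers of [b] is prime. *)
Lemma prime_radical (J : set R^o) (b : R) : submodule J ->
    (forall p : prime_idealr R, (forall x, J x -> x \in (p : {pred R})) ->
       b \in (p : {pred R})) ->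
  exists n, J (b ^+ n).
Proof.
move=> smJ bP; apply: contrapT => nJ.
have [|K [smK JK Kb Kmax]] :=
    submodule_Zorn (X := [set x : R^o | exists n, x = b ^+ n]) (Y := set0) smJ.
  by move=> x [Jx [n xE]]; apply: nJ; exists n; rewrite -xE.
have nK n : ~ K (b ^+ n) by move=> Kn; apply: (Kb (b ^+ n)); split=> //; exists n.
have powK u : ~ K u -> exists n c k, K k /\ b ^+ n = k + c * u.
  move=> nKu; apply: contrapT => nex; apply: nKu.
  apply: (Kmax (addm K (lspan (V := R^o) [:: u]))).
  - exact: submodule_addm (submodule_lspan _).
  - exact: addm_subl (submodule_lspan _).
  - move=> _ [[k [_ [Kk /= [c [_ [-> ->]]] ->]]] [n nE]]; apply: nex.
    by exists n, c, k; rewrite -nE addr0.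
  - by apply: addm_subr => //; apply: mem_lspan; rewrite mem_head.
pose P : {pred R} := [pred x | `[< K x >]].
have Pid : idealr_closed P.
  split; first by apply/asboolP; exact: submodule0 smK.
    by apply/negP => /asboolP; have := nK 0%N; rewrite expr0.
  by move=> a u v /asboolP Ku /asboolP Kv; apply/asboolP; apply: smK.2.
have Ppr : prime_idealr_closed P.
  move=> u v /asboolP Kuv; apply/orP; apply: contrapT => /not_orP[nPu nPv].
  have [|i [c [k [Kk iE]]]] := powK u; first by move=> Ku; apply: nPu; apply/asboolP.
  have [|j [d [k' [Kk' jE]]]] := powK v; first by move=> Kv; apply: nPv; apply/asboolP.
  apply: (nK (i + j)%N); rewrite exprD iE mulrDl; apply: (submoduleD smK).
    by rewrite mulrC; apply: (submoduleZ smK _ Kk).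
  rewrite jE mulrDr; apply: (submoduleD smK); first exact: (submoduleZ smK _ Kk').
  by rewrite mulrACA; apply: (submoduleZ smK _ Kuv).
pose Pb1 := isIdealr.Build R P Pid.
pose Pb2 := isPrimeIdealrClosed.Build R P Ppr.
pose p : prime_idealr R := HB.pack P Pb1 Pb2.
have : b \in (p : {pred R}) by apply: bP => x /JK Kx; apply/asboolP.
by move/asboolP; have := nK 1%N; rewrite expr1.
Qed.

(** Every prime containing Ann L lies in Cosupp V, hence contains [I]; so [b] lies in the radical of
    Ann L. *)
Lemma cosupp_power (I : ideal R) V L (h : {linear V -> L}) b :
    cosupp m V `<=` V_ideal I -> cocyclic m L -> (forall y, exists x, h x = y) ->
  b \in I -> exists n, forall y : L, b ^+ n *: y = 0.
Proof.
move=> VI cocL surjh bI.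
have smann : submodule [set r : R^o | forall y : L, r *: y = 0].
  split=> [y|a u v u0 v0 y]; first by rewrite scale0r.
  by rewrite scalerDl -[(a *: u) *: y]scalerA u0 v0 scaler0 addr0.
have [p annp|n nP] := prime_radical (b := b) smann; last by exists n.
apply: VI bI; exists L; first by split=> //; exists h.
by move=> r /asboolP; apply: annp.
Qed.

Section Envelope.
Variable E : lmodType R.
Hypothesis envE : injective_envelope (quotmod m) E.

(** Essentiality says that 0 is maximal among the submodules meeting the image of R/m trivially, and
    [m] kills that image; [maximal_torsion] applies with [K] = 0. *)
Lemma envelope_torsion (a : R) (x : E) : a \in m -> exists n, a ^+ n *: x = 0.
Proof.
move=> am; have [_ [j injj jess]] := envE.
have smj : submodule (range j) by apply: submodule_image.
have sm0 := submodule_set0 E.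
apply: (maximal_torsion noethR (B := range j) (U := [set 0]) sm0) => //.
- move=> K smK _ Kj x' Kx'; apply: contrapT => x'0.
  have [S SE] := submodule_pred smK.
  have [|q Sjq jq0] := jess S; first by exists x'; [apply/SE|apply/eqP].
  case/eqP: jq0; apply: Kj; split; [exact/SE|by exists q].
- by move=> _ [q _ <-] /=; rewrite -linearZ quotmod_annihilated // linear0.
Qed.

(** For [K] maximal among the submodules containing [B] but not [x], every nonzero submodule of V /
    K contains the class of [x], which [m] kills. The embedding of R/m into [E] extends to V / K by
    injectivity, and stays injective. *)
Lemma cocyclic_quotient V (B : set V) x : submodule B -> ~ B x ->
  exists L (h : {linear V -> L}), [/\ cocyclic m L, forall y, exists x, h x = y,
    forall y, B y -> h y = 0 & h x <> 0].
Proof.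
move=> smB nBx.
have [|K [smK BK Kx Kmax]] := submodule_Zorn (X := [set x]) (Y := set0) smB.
  by move=> y [By /= yE]; apply: nBx; rewrite -yE.
have nKx : ~ K x by move=> K'x; apply: (Kx x).
have Kex z : ~ K z -> exists r k, K k /\ x = k + r *: z.
  move=> nKz; apply: contrapT => nex; apply: nKz.
  apply: (Kmax (addm K (lspan [:: z]))).
  - exact: submodule_addm (submodule_lspan _).
  - exact: addm_subl (submodule_lspan _).
  - move=> _ [[k [_ [Kk [c [_ [-> ->]]] ->]]] nE]; apply: nex.
    by exists c, k; rewrite -nE addr0.
  - by apply: addm_subr => //; apply: mem_lspan; rewrite mem_head.
have mKx (a : R) : a \in m -> K (a *: x).
  move=> am; apply: contrapT => /Kex[r [k [Kk xE]]]; apply: nKx.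
  have [d dE] : exists d, d * (1 - r * a) = 1.
    by apply: (local_unitB localR); apply: idealMl.
  suff -> : x = d *: k by apply: submoduleZ.
  have -> : k = (1 - r * a) *: x.
    by rewrite scalerBl scale1r -scalerA {1}xE addrK.
  by rewrite scalerA dE scale1r.
have [S SE] := submodule_pred smK.
pose h := quot_pi S; exists (quotmod S), h.
have h0 y : h y = 0 <-> K y.
  rewrite -[0](linear0 (quot_pi S)) -SE -[y in y \in S]subr0 -quot_piE.
  by split=> [/eqP|/eqP].
split; first last.
- by move/h0.
- by move=> y /BK/h0.
- by move=> y; exists (repr y); apply: quot_piK.
exists E => //; have [injE [j injj jess]] := envE.
(* The map 1 |-> h(x); it does not depend on representatives because m x lies in [K]. *)
pose i (q : quotmod m) : quotmod S := h ((repr q : R) *: x).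
have iE (q : R) : i (quot_pi m q) = q *: h x.
  apply/eqP; rewrite /i -linearZ -subr_eq0 -linearB -scalerBl.
  by apply/eqP/h0/mKx/repr_quot_pi.
have i_lin : linear i.
  move=> a q q'; rewrite -(quot_piK q) -(quot_piK q') -linearP !iE.
  by rewrite scalerDl scalerA.
pose ib := GRing.isLinear.Build R (quotmod m) (quotmod S) *:%R i i_lin.
pose iL : {linear quotmod m -> quotmod S} := HB.pack i ib.
have [|g gP] := injE _ _ iL j.
  apply: raddf_inj => q; rewrite -(quot_piK q) /= iE -linearZ => /h0 Kqx.
  have [qm|/(local_unit localR)[c cq]] := boolP ((repr q : R) \in m).
    apply/eqP; rewrite -[0](linear0 (quot_pi m)) quot_piE subr0; exact: qm.
  by case: nKx; rewrite -[x]scale1r -cq -scalerA; apply: submoduleZ.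
exists g; apply: raddf_inj => l; rewrite -(quot_piK l) => gl0.
apply/h0; apply: contrapT => /Kex[r [k [/h0 Kk xE]]].
have : g (iL (quot_pi m 1)) = 0.
  have hE : h x = r *: h (repr l).
    by rewrite {1}xE /h quot_piD -/(h k) Kk add0r linearZ.
  by rewrite /= iE scale1r hE linearZ /= gl0 scaler0.
rewrite gP => /eqP; rewrite -[0](linear0 j) => /eqP/injj/eqP.
rewrite -[0](linear0 (quot_pi m)) quot_piE subr0.
exact/negP/local_1notin.
Qed.

Lemma cosupp_power_fg (I : ideal R) V (s : seq V) b :
    fin_socles m V ->
    (forall (a : R) x, a \in m -> exists k, lspan s (a ^+ k *: x)) ->
    cosupp m V `<=` V_ideal I -> b \in I ->
  power_fg b V.
Proof.
move=> finV tors VI bI; have sms := submodule_lspan s.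
pose S n := addm (lspan s) (range (fun x : V => b ^+ n *: x)).
have smS n : submodule (S n) by apply: submodule_addm => //; apply: submodule_scale.
have sS n : lspan s `<=` S n by apply: addm_subl; apply: submodule_scale.
have [||n nP] := fin_socles_artinian noethR localR finV smS.
- move=> n; apply: addm_mono => _ [x _ <-]; exists (b *: x) => //.
  by rewrite scalerA -exprSr.
- by move=> a x am; have [k sk] := tors a x am; exists k => n; apply: sS.
exists n, s => x; apply: contrapT => nsx.
(* This quotient kills <s> but not b^n x, while some b^k kills all of it; yet b^n x lies in <s> +
   b^k V by stationarity. *)
have [L [h [cocL surjh sh hx]]] := cocyclic_quotient sms nsx.
have [k kP] := cosupp_power VI cocL surjh bI.
have [|u [_ [su [w _ <-] xE]]] := nP k (b ^+ n *: x).
  by apply: addm_subr => //; exists x.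
by apply: hx; rewrite xE linearD linearZ /= kP sh // addr0.
Qed.

(** On a cocyclic quotient [b] would be both invertible and nilpotent, so there is no nonzero
    cocyclic quotient. *)
Lemma cosupp_unit (I : ideal R) V b : cosupp m V `<=` V_ideal I ->
  b \in I -> b \notin m -> forall x : V, x = 0.
Proof.
move=> VI bI /(local_unit localR)[c cb] x; apply: contrapT => x0.
have [L [h [cocL surjh _ hx]]] := cocyclic_quotient (submodule_set0 V) x0.
have [k kP] := cosupp_power VI cocL surjh bI; apply: hx.
by rewrite -[h x]scale1r -(expr1n _ k) -cb exprMn -scalerA kP scaler0.
Qed.

End Envelope.

(** [L] embeds in an m-torsion module, so one power of [b] kills the finitely many images h(s), and
    with them b^n L. *)
Lemma power_fg_cocyclic V L (h : {linear V -> L}) (b : R) :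
    b \in m -> power_fg b V -> cocyclic m L -> (forall y, exists x, h x = y) ->
  exists n, forall y : L, b ^+ n *: y = 0.
Proof.
move=> bm [n [s sP]] [E envE [f injf]] surjh.
have torL (y : L) : exists k, b ^+ k *: y = 0.
  have [k fk] := envelope_torsion envE (f y) bm; exists k.
  by apply: injf; rewrite linearZ /= fk linear0.
have [k kP] : exists k, forall y, y \in map h s -> b ^+ k *: y = 0.
  apply: (@chain_seq _ (fun k => [set y : L | b ^+ k *: y = 0])) => [k y /= ky|y _].
    by rewrite exprS -scalerA ky scaler0.
  exact: torL.
exists (k + n)%N => y; have [x <-] := surjh y.
rewrite exprD -scalerA; have <- : h (b ^+ n *: x) = b ^+ n *: h x by rewrite linearZ.
move: (sP x).
suff : lspan s `<=` [set v | b ^+ k *: h v = 0] by move=> sub /sub.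
apply: lspan_sub => [|v vs]; last by apply/kP/map_f.
split=> [|a u v] /=; first by rewrite linear0 scaler0.
by rewrite linearP scalerDr scalerA mulrC -scalerA => -> ->; rewrite scaler0 addr0.
Qed.

End Cosupport.

(** * Free modules and tensor products *)

Section FreeModules.
Variables (R : comNzRingType) (X : choiceType).

Lemma freemod_ind (K : set (freemod R X)) : submodule K ->
  (forall x, K (basis R x)) -> forall c, K c.
Proof.
move=> smK Kb c; have [A cA] := coeff_supp c.
have -> : c = \sum_(x <- A) coeff c x *: basis R x.
  apply: val_inj; rewrite raddf_sum; apply/funext => y.
  rewrite fct_sumE -[LHS]/(coeff c y).
  transitivity (\sum_(x <- A) coeff c x * (y == x)%:R); last first.
    by apply: eq_bigr.
  have [yA|yA] := boolP (y \in A).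
    rewrite (bigD1_seq y) ?fset_uniq //= eqxx mulr1 big1 ?addr0 // => x.
    by rewrite eq_sym => /negPf ->; rewrite mulr0.
  rewrite cA // big1_seq // => x /= xA.
  by case: eqP => [yx|_]; [rewrite yx xA in yA | rewrite mulr0].
by elim/big_ind: _ => [|u v|x _]; [apply: submodule0|apply: submoduleD|apply: submoduleZ].
Qed.

Lemma freemod_lift (V W : lmodType R) (g : {linear W -> V}) (f : freemod R X -> V) :
    linear f -> (forall x, exists w, g w = f (basis R x)) ->
  exists h : {linear freemod R X -> W}, forall c, g (h c) = f c.
Proof.
move=> f_lin /choice[w gw]; exists (free_lift w).
pose fb := GRing.isLinear.Build R (freemod R X) V *:%R f f_lin.
pose fL : {linear freemod R X -> V} := HB.pack f fb.
apply: freemod_ind => [|x]; last by rewrite /= free_lift_basis gw.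
have f0 : f 0 = 0 by exact: (linear0 fL).
split=> [|a u v gu gv]; first by rewrite /= f0 !linear0.
by rewrite f_lin !linearP gu gv.
Qed.

End FreeModules.

Section Tensors.
Variables (R : comNzRingType) (M : lmodType R).
Implicit Types N W : lmodType R.

Lemma tensor_ind N (K : set (tensor N M)) : submodule K ->
  (forall x y, K (tens x y)) -> forall z, K z.
Proof.
move=> smK Kt z; rewrite -(quot_piK z); move: (repr z).
by apply: (freemod_ind (submodule_preim (quot_pi _) smK)) => -[x y]; apply: Kt.
Qed.

Lemma tens0l N (y : M) : tens (0 : N) y = 0.
Proof.
by have := tens_linearl y (-1) (0 : N) 0; rewrite scaler0 addr0 scaleN1r addNr.
Qed.

Lemma tens0r N (x : N) : tens x (0 : M) = 0.
Proof.
by have := tens_linearr x (-1) (0 : M) 0; rewrite scaler0 addr0 scaleN1r addNr.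
Qed.

Lemma tensor_lift_tens N W (b : N -> M -> W) x y :
    (forall y, linear (b^~ y)) -> (forall x, linear (b x)) ->
  tensor_lift b (tens x y) = b x y.
Proof. by move=> bl br; rewrite tensor_lift_pi // free_lift_basis. Qed.

Lemma tensor_map_tens N N' (f : {linear N -> N'}) x y :
  tensor_map M f (tens x y) = tens (f x) y.
Proof.
rewrite /tensor_map tensor_lift_tens // => [y' a u v|x' a u v].
  by rewrite linearP tens_linearl.
exact: tens_linearr.
Qed.

Lemma submodule_eq (V W : lmodType R) (f g : {linear V -> W}) :
  submodule [set x | f x = g x].
Proof. by split=> [|a u v /= fu fv]; rewrite /= ?linear0 // !linearP fu fv. Qed.

Lemma tensor_map_comp N N' N'' (f : {linear N -> N'}) (g : {linear N' -> N''})
    (h : {linear N -> N''}) : (forall x, h x = g (f x)) ->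
  forall z, tensor_map M h z = tensor_map M g (tensor_map M f z).
Proof.
move=> hE; apply: tensor_ind => [|x y]; last by rewrite /= !tensor_map_tens hE.
exact: (submodule_eq (tensor_map M h) (tensor_map M g \o tensor_map M f)).
Qed.

Lemma tensor_map0 N N' (f : {linear N -> N'}) : (forall x, f x = 0) ->
  forall z, tensor_map M f z = 0.
Proof.
move=> f0; apply: tensor_ind => [|x y].
  by split=> [|a u v fu fv]; rewrite ?linear0 // linearP /= fu fv scaler0 addr0.
rewrite /= tensor_map_tens f0.
exact: tens0l.
Qed.

End Tensors.

(** * Homology of a pair of maps: annihilation and Serre classes *)

Section HomologyLemmas.
Variables (R : comNzRingType) (U V W : lmodType R).
Variables (f : {linear U -> V}) (g : {linear V -> W}).

Lemma homology_kill (a : R) :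
    (forall z, g z = 0 -> exists x, f x = a *: z) ->
  forall h : homology f g, a *: h = 0.
Proof.
move=> fa h; rewrite -(quot_piK h) -linearZ -[RHS](linear0 (quot_pi _)).
apply/eqP; rewrite quot_piE subr0; apply/boundaryP; apply: fa.
by case: (repr h) => z /= /eqP.
Qed.

(** Modulo boundaries every cycle [z] equals [Q (H z)], so the homology is a quotient of the
    submodule ker (g o Q) of M^r. *)
Lemma homology_serre (C : lmodType R -> Prop) (M : lmodType R) r
    (H : {linear V -> {ffun 'I_r -> M}}) (Q : {linear {ffun 'I_r -> M} -> V}) :
    serre_class C -> C M -> (forall x, g (f x) = 0) ->
    (forall z, g z = 0 -> exists x, z = Q (H z) + f x) ->
  C (homology f g).
Proof.
move=> serreC CM gf0 zE.
pose D := submod (lin_ker (g \o Q)).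
have CD : C D.
  apply: (serre_inj serreC (f := (val : {linear D -> _}))); first exact: val_inj.
  exact: serre_ffun.
have kerQ (u : D) : Q (val u) \in lin_ker g by exact: (valP u).
pose e (u : D) : homology f g := quot_pi (boundary (g := g) f) (Submod (kerQ u)).
have e_lin : linear e.
  move=> a u v; rewrite /e -linearP; congr (quot_pi _ _); apply: val_inj.
  by rewrite /= !linearP.
pose eb := GRing.isLinear.Build R D (homology f g) *:%R e e_lin.
pose eL : {linear D -> homology f g} := HB.pack e eb.
apply: (serre_surj serreC (f := eL)) CD => h; rewrite -(quot_piK h).
case: (repr h) => z gz; have [x zQ] : exists x, z = Q (H z) + f x.
  by apply: zE; apply/eqP.
have QHz : H z \in lin_ker (g \o Q).
  rewrite inE /=; have -> : Q (H z) = z - f x by rewrite {2}zQ addrK.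
  by rewrite linearB gf0 subr0.
exists (Submod QHz); apply/eqP; rewrite /= quot_piE; apply/boundaryP; exists (- x).
by rewrite linearN /= {2}zQ opprD addNKr.
Qed.

Lemma homology_coker : (forall z, g z = 0) ->
  exists F : V -> homology f g, linear F /\ forall z, F z = 0 -> exists x, f x = z.
Proof.
move=> g0; have kg z : z \in lin_ker g by rewrite inE g0.
exists (fun z => quot_pi (boundary (g := g) f) (Submod (kg z))); split.
  by move=> a u v; rewrite -linearP; congr (quot_pi _ _); apply: val_inj.
move=> z Fz0; have /boundaryP[x xE] : Submod (kg z) \in boundary (g := g) f.
  by rewrite -[Submod _]subr0 -quot_piE linear0; apply/eqP.
by exists x.
Qed.

End HomologyLemmas.

(** * Tor *)

Section Resolution.
Variables (R : comNzRingType) (N : lmodType R).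

Local Notation P := (resolution N).
Local Notation d n := (@resolution_diff R N n).

Lemma free_cover_basis (V : lmodType R) (x : V) : free_cover (basis R x) = x.
Proof. exact: free_lift_basis. Qed.

Lemma resolution_exact n (p : P n) : free_cover p = 0 -> exists q, d n q = p.
Proof.
move=> p0; have kp : p \in lin_ker (@free_cover R (syzygy N n)).
  by rewrite inE p0.
by exists (basis R (Submod kp)); rewrite /resolution_diff free_cover_basis.
Qed.

Lemma free_cover_diff n (q : P n.+1) : free_cover (d n q) = 0.
Proof. by apply/eqP; apply: (valP (free_cover q : syzygy N n.+1)). Qed.

Lemma free_cover_eq0 n (p : P n.+1) : d n p = 0 -> free_cover p = 0.
Proof. by move=> p0; apply: val_inj. Qed.

Lemma diff_diff n (q : P n.+2) : d n (d n.+1 q) = 0.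
Proof. by rewrite {1}/resolution_diff free_cover_diff. Qed.

(** The part of a homotopy that factors through the outgoing differential; it vanishes in degree 0,
    where that differential is 0. *)
Definition via_diff n : {linear P n -> P n} -> Prop :=
  match n with
  | 0 => fun t => forall p, t p = 0
  | k.+1 => fun t => exists u : {linear P k -> P k.+1}, forall p, t p = u (d k p)
  end.

(* The term [t p] vanishes on cycles, so that multiplication by [a] and [phi]
   induce the same map on the n-th homology of P (x) M. *)
Definition homotopic n (a : R) (phi : {linear P n -> P n}) : Prop :=
  exists (s : {linear P n -> P n.+1}) (t : {linear P n -> P n}),
    via_diff t /\ forall p, a *: p = phi p + d n (s p) + t p.

Lemma via_diff_cycle n (t : {linear P n -> P n}) p :
  via_diff t -> free_cover p = 0 -> t p = 0.
Proof.
case: n t p => [|n] t p /=; first by move=> ->.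
by case=> u -> p0; have [q <-] := resolution_exact (n := n.+1) p0; rewrite diff_diff linear0.
Qed.

Lemma lift_diff n (f : P n -> P n) : linear f ->
    (forall p, free_cover (f p) = 0) ->
  exists s : {linear P n -> P n.+1}, forall p, d n (s p) = f p.
Proof. by move=> f_lin f0; apply: freemod_lift => // x; apply: resolution_exact. Qed.

Lemma homotopic0 (a : R) (phi : {linear P 0 -> P 0}) :
  (forall p : P 0, free_cover (phi p) = a *: free_cover p) -> homotopic a phi.
Proof.
move=> phiE; pose idP : {linear P 0 -> P 0} := idfun.
have [|s sE] := lift_diff (linearP (a \*: idP \- phi)).
  by move=> p; rewrite linearB linearZ /= phiE subrr.
exists s, \0; split=> // p.
by rewrite sE /= addr0 addrC subrK.
Qed.

(** Inductive step of the comparison theorem: a p - psi p - s (d p) is a cycle, hence lifts along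
    the next differential. *)
Lemma homotopicS n (a : R) (phi : {linear P n -> P n})
    (psi : {linear P n.+1 -> P n.+1}) : homotopic a phi ->
  (forall p, d n (psi p) = phi (d n p)) -> homotopic a psi.
Proof.
move=> [s [t [tP aE]]] psiE.
pose idP : {linear P n.+1 -> P n.+1} := idfun.
have [|s' s'E] := lift_diff (linearP (a \*: idP \- psi \- (s \o d n))).
  move=> p; apply: free_cover_eq0; rewrite /= !linearB linearZ /= psiE aE.
  rewrite (via_diff_cycle tP (free_cover_diff _)) addr0.
  by rewrite [phi _ + _]addrC addrK subrr.
exists s', (s \o d n); split; first by exists s.
by move=> p; rewrite s'E /= -addrA subrK addrC subrK.
Qed.

Lemma lspan_sum (V : lmodType R) (s : seq V) x : lspan s x ->
  exists u : {ffun 'I_(size s) -> R^o}, x = \sum_j u j *: s`_j.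
Proof.
elim: s x => [|y s IHs] x /=; first by move->; exists 0; rewrite big_ord0.
case=> a [v [/IHs[u ->] ->]].
exists [ffun i => if unlift ord0 i is Some j then u j else a].
rewrite big_ord_recl ffunE unlift_none; congr (_ + _); apply: eq_bigr => j _.
by rewrite ffunE liftK.
Qed.

Definition finite_rank n (phi : {linear P n -> P n}) : Prop :=
  exists r (h : {linear P n -> {ffun 'I_r -> R^o}}) (q : 'I_r -> P n),
    forall p, phi p = \sum_j h p j *: q j.

Lemma ffun_sum_linear (V W : lmodType R) r (h : {linear V -> {ffun 'I_r -> R^o}})
    (q : 'I_r -> W) : linear (fun p => \sum_j h p j *: q j).
Proof.
move=> a u v; rewrite scaler_sumr -big_split; apply: eq_bigr => j _.
by rewrite linearP !ffunE scalerDl scalerA.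
Qed.

Lemma lift_lspan n (V : lmodType R) (f : {linear P n -> V}) (s : seq V) :
    (forall p, lspan s (f p)) ->
  exists h : {linear P n -> {ffun 'I_(size s) -> R^o}},
    forall p, \sum_j h p j *: s`_j = f p.
Proof.
move=> sf; pose g (u : {ffun 'I_(size s) -> R^o}) := \sum_j u j *: s`_j.
have g_lin : linear g by apply: (ffun_sum_linear idfun).
pose gb := GRing.isLinear.Build R _ V *:%R g g_lin.
pose gL : {linear {ffun 'I_(size s) -> R^o} -> V} := HB.pack g gb.
have [|x|h hP] := @freemod_lift R _ V _ gL f; last by exists h.
  exact: linearP.
by have [u ->] := lspan_sum (sf (basis R x)); exists u.
Qed.

(** In degree 0 the cover P_0 -> N is lifted through the generators of [N]. If phi factors through h
    : P_n -> R^r, the image of h o d is finitely generated, which yields a finite rank map psi with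
    d psi = phi d. *)
Lemma finite_rank_homotopic : noetherian R -> finitely_generated (@predT N) ->
  forall n, exists2 phi : {linear P n -> P n}, finite_rank phi & homotopic 1 phi.
Proof.
move=> noethR [s sN]; elim=> [|n [phi [r [h [q phiE]]] hphi]].
  have [|h hE] := @lift_lspan 0 N (@free_cover R N) s.
    by move=> p; apply/lspan_spanE; rewrite sN.
  have phi_lin := ffun_sum_linear h (fun j => basis R s`_j : P 0).
  pose phib := GRing.isLinear.Build R (P 0) (P 0) *:%R _ phi_lin.
  pose phi : {linear P 0 -> P 0} :=
    HB.pack (fun p => \sum_j h p j *: (basis R s`_j : P 0)) phib.
  exists phi; first by exists (size s), h, (fun j => basis R s`_j).
  apply: homotopic0 => p; rewrite scale1r /= linear_sum -hE.
  by apply: eq_bigr => j _; rewrite linearZ /= free_cover_basis.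
have [s1 [t [tP aE]]] := hphi.
pose A := (h \o d n) : {linear P n.+1 -> {ffun 'I_r -> R^o}}.
pose e (j : 'I_r) : {ffun 'I_r -> R^o} := [ffun i => (i == j)%:R].
have [||l lE] := noetherian_sub noethR (s := map e (enum 'I_r)) (A := range A).
- exact: submodule_image.
- move=> u _; have -> : u = \sum_j u j *: e j.
    apply/ffunP => i; rewrite sum_ffunE (bigD1 i) //= big1 => [|j ji].
      by rewrite !ffunE eqxx addr0 /GRing.scale /= mulr1.
    by rewrite !ffunE eq_sym (negPf ji) scaler0.
  elim/big_ind: _ => [|x y|j _]; [apply: submodule0|apply: submoduleD|apply: submoduleZ];
    try exact: submodule_lspan.
  by apply: mem_lspan; apply: map_f; rewrite mem_enum.
have [ps _ psE] : exists2 ps, (forall p, p \in ps -> [set: P n.+1] p) & map A ps = l.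
  by apply: image_map => y /mem_lspan; rewrite lE.
have lE' k : (k < size l)%N -> l`_k = A ps`_k.
  by rewrite -psE size_map => ltk; rewrite (nth_map 0).
have [|h' h'E] := @lift_lspan n.+1 _ A l; first by move=> p; rewrite lE; exists p.
(* The correction by the homotopy [s1] makes [d n (q' j)] equal to [phi (d n ps_j)]. *)
pose q' (j : 'I_(size l)) : P n.+1 := ps`_j - s1 (d n ps`_j).
have psi_lin := ffun_sum_linear h' q'.
pose psib := GRing.isLinear.Build R (P n.+1) (P n.+1) *:%R _ psi_lin.
pose psi : {linear P n.+1 -> P n.+1} := HB.pack (fun p => \sum_j h' p j *: q' j) psib.
exists psi; first by exists (size l), h', q'.
apply: (homotopicS hphi) => p; rewrite /= linear_sum /=.
have dq' j : d n (q' j) = phi (d n ps`_j).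
  have dE : d n ps`_j = phi (d n ps`_j) + d n (s1 (d n ps`_j)).
    by rewrite -{1}[d n _]scale1r aE (via_diff_cycle tP (free_cover_diff _)) addr0.
  by rewrite linearB /= {1}dE addrK.
under eq_bigr do rewrite linearZ /= dq' phiE.
rewrite phiE; under [RHS]eq_bigr => i _.
  rewrite -[h _]/(A p) -h'E sum_ffunE scaler_suml.
  over.
rewrite exchange_big; apply: eq_bigr => j _; rewrite scaler_sumr.
by apply: eq_bigr => i _; rewrite !ffunE scalerA lE'.
Qed.

(** Multiplication by [a] and 0 are both lifts of the zero map of [N]. *)
Lemma annihilator_homotopic (a : R) : a \in ann N ->
  forall n, homotopic a (\0 : {linear P n -> P n}).
Proof.
move=> /asboolP aN; elim=> [|n IHn]; last by apply: homotopicS IHn _ => p; rewrite linear0.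
by apply: homotopic0 => p; rewrite /= aN linear0.
Qed.

End Resolution.

(** * Consequences of the homotopies for Tor *)

Section TorLemmas.
Variables (R : comNzRingType) (N M : lmodType R).

Local Notation P := (resolution N).
Local Notation d n := (@resolution_diff R N n).

Definition tensor_cycle n : tensor (P n) M -> Prop :=
  if n is k.+1 return tensor (P n) M -> Prop
  then fun z => tensor_map M (d k) z = 0 else fun=> True.

Lemma tensor_homotopy n (a : R) (phi : {linear P n -> P n}) : homotopic a phi ->
  forall z, tensor_cycle z ->
    exists x, tensor_map M phi z + tensor_map M (d n) x = a *: z.
Proof.
move=> [s [t [tP aE]]] z zc; exists (tensor_map M s z).
have tz : tensor_map M t z = 0.
  case: n phi s t {aE} tP z zc => [|n] phi s t tP z zc; first exact: tensor_map0.
  have [u tE] := tP; rewrite (tensor_map_comp (f := d n) (g := u)) //.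
  by have -> : tensor_map M (d n) z = 0 by []; rewrite linear0.
rewrite -[LHS]addr0 -{}tz; move: z {zc}; apply: tensor_ind => [|p y] /=.
  pose idT : {linear tensor (P n) M -> tensor (P n) M} := idfun.
  exact: (submodule_eq (tensor_map M phi \+ (tensor_map M (d n) \o tensor_map M s)
                          \+ tensor_map M t) (a \*: idT)).
rewrite !tensor_map_tens; have tensD u v : tens (u + v) y = tens u y + tens v y.
  by have := tens_linearl y 1 u v; rewrite !scale1r.
rewrite -!tensD -aE; have := tens_linearl y a p 0.
by rewrite tens0l !addr0.
Qed.

(** Tensored with [M], the factorization of [phi] through R^r becomes one through M^r. *)
Lemma tensor_finite_rank n (phi : {linear P n -> P n}) : finite_rank phi ->
  exists r (H : {linear tensor (P n) M -> {ffun 'I_r -> M}})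
    (Q : {linear {ffun 'I_r -> M} -> tensor (P n) M}),
  forall z, tensor_map M phi z = Q (H z).
Proof.
move=> [r [h [q phiE]]].
pose b (p : P n) (y : M) : {ffun 'I_r -> M} := [ffun j => h p j *: y].
have bl y : linear (b^~ y).
  by move=> a u v; apply/ffunP => j; rewrite !ffunE linearP !ffunE scalerDl scalerA.
have br p : linear (b p).
  by move=> a u v; apply/ffunP => j; rewrite !ffunE scalerDr !scalerA mulrC.
have H_lin := tensor_lift_linear bl br.
have Q_lin : linear (fun u : {ffun 'I_r -> M} => \sum_j tens (q j) (u j)).
  move=> a u v; rewrite scaler_sumr -big_split; apply: eq_bigr => j _.
  by rewrite !ffunE tens_linearr.
pose Hb := GRing.isLinear.Build R (tensor (P n) M) {ffun 'I_r -> M} *:%R _ H_lin.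
pose H : {linear tensor (P n) M -> {ffun 'I_r -> M}} := HB.pack (tensor_lift b) Hb.
pose Qb := GRing.isLinear.Build R {ffun 'I_r -> M} (tensor (P n) M) *:%R _ Q_lin.
pose Q : {linear {ffun 'I_r -> M} -> tensor (P n) M} :=
  HB.pack (fun u : {ffun 'I_r -> M} => \sum_j tens (q j) (u j)) Qb.
exists r, H, Q; apply: tensor_ind => [|p y].
  exact: (submodule_eq (tensor_map M phi) (Q \o H)).
rewrite /= tensor_map_tens tensor_lift_tens // phiE.
pose T (p : P n) : tensor (P n) M := tens p y.
pose Tb := GRing.isLinear.Build R (P n) (tensor (P n) M) *:%R T (tens_linearl y).
pose TL : {linear P n -> tensor (P n) M} := HB.pack T Tb.
rewrite -[LHS]/(TL _) linear_sum; apply: eq_bigr => j _; rewrite ffunE linearZ /= /T.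
have := tens_linearr (q j) (h p j) y 0.
by rewrite tens0r !addr0.
Qed.

Lemma tensor_diff_diff n (x : tensor (P n.+2) M) :
  tensor_map M (d n) (tensor_map M (d n.+1) x) = 0.
Proof.
rewrite -(tensor_map_comp (f := d n.+1) (g := d n) (h := \0)).
  exact: tensor_map0.
by move=> q; rewrite /= diff_diff.
Qed.

Lemma Tor_serre (C : lmodType R -> Prop) i : noetherian R -> serre_class C ->
  finitely_generated (@predT N) -> C M -> C (Tor N M i).
Proof.
move=> noethR serreC fgN CM.
have [phi /tensor_finite_rank[r [H [Q phiE]]] hphi] :=
  finite_rank_homotopic noethR fgN i.
have zE z : tensor_cycle z -> exists x, z = Q (H z) + tensor_map M (d i) x.
  by move=> /(tensor_homotopy hphi)[x xE]; exists x; rewrite -phiE xE scale1r.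
case: i phi hphi H Q phiE zE => [|i] phi hphi H Q phiE zE.
  by apply: (homology_serre (H := H) (Q := Q) serreC CM) => // z _; apply: zE.
apply: (homology_serre (H := H) (Q := Q) serreC CM) => [x|z /zE//].
exact: tensor_diff_diff.
Qed.

Lemma Tor_annihilator (a : R) i : a \in ann N -> forall h : Tor N M i, a *: h = 0.
Proof.
move=> /annihilator_homotopic/(_ i) hphi.
have zE (z : tensor (P i) M) : tensor_cycle z -> exists x, tensor_map M (d i) x = a *: z.
  move=> /(tensor_homotopy hphi)[x <-]; exists x.
  by rewrite (tensor_map0 (f := \0)) ?add0r.
case: i {hphi} zE => [|i] zE h.
  by apply: homology_kill => z _; apply: zE.
by apply: homology_kill => z; apply: zE.
Qed.

Lemma Tor0_coker : exists F : tensor (P 0%N) M -> Tor N M 0%N,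
  linear F /\ forall z, F z = 0 -> exists x, tensor_map M (d 0%N) x = z.
Proof. by apply: homology_coker. Qed.

End TorLemmas.

(** * Comparison of Tor_0(R/I, M) with M / I M *)

Section TorZero.
Variables (R : comNzRingType) (I : ideal R) (M : lmodType R).

Lemma quotmod_repr : exists rho : quotmod I -> R,
  [/\ forall a q q', rho (a *: q + q') - (a * rho q + rho q') \in I,
      rho 0 \in I & rho (quot_pi I 1) - 1 \in I].
Proof.
exists (fun q => repr q : R); split=> [a q q'||]; last exact: (repr_quot_pi I 1).
  rewrite -{1}(quot_piK q) -{1}(quot_piK q') -quot_pi_linear.
  exact: (repr_quot_pi I (a *: repr q + repr q')).
rewrite -[0](linear0 (quot_pi I)) -[repr _]subr0.
exact: (repr_quot_pi I 0).
Qed.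

(** [F] sends x to the class of e (x) x with [e] over 1. The map [B] to M / I M kills boundaries and
    sends e (x) x to the class of x, so the kernel of [F] lies in I M. *)
Lemma Tor0_quotient : exists F : M -> Tor (quotmod I) M 0%N,
  linear F /\ forall x, F x = 0 -> imul I [set: M] x.
Proof.
have [rho [rhoP rho0 rho1]] := quotmod_repr.
have [S SE] := submodule_pred (submodule_imul I [set: M]).
have SI (c : R) y : c \in I -> quot_pi S (c *: y) = 0.
  move=> cI; rewrite -[0](linear0 (quot_pi S)); apply/eqP.
  by rewrite quot_piE subr0; apply/SE; apply: (mem_imul cI).
have SIB (c c' : R) y : c - c' \in I -> quot_pi S (c *: y) = quot_pi S (c' *: y).
  by move=> /SI-/(_ y); rewrite scalerBl linearB => /eqP; rewrite subr_eq0 => /eqP.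
pose P := resolution (quotmod I).
pose b (p : P 0%N) (y : M) : quotmod S := quot_pi S (rho (free_cover p) *: y).
have bl y : linear (b^~ y).
  move=> a u v; rewrite /b linearP (SIB _ _ y (rhoP _ _ _)).
  by rewrite scalerDl -scalerA linearP.
have br p : linear (b p).
  by move=> a u v; rewrite /b scalerDr scalerA mulrC -scalerA linearP.
have B_lin := tensor_lift_linear bl br.
pose Bb := GRing.isLinear.Build R (tensor (P 0%N) M) (quotmod S) *:%R _ B_lin.
pose B : {linear tensor (P 0%N) M -> quotmod S} := HB.pack (tensor_lift b) Bb.
pose e : P 0%N := basis R (quot_pi I 1).
have [G [G_lin G0]] := Tor0_coker (quotmod I) M.
exists (fun x => G (tens e x)); split=> [a u v|x /G0[w wE]].
  by rewrite tens_linearr G_lin.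
have Bx : B (tens e x) = quot_pi S x.
  by rewrite /= tensor_lift_tens // /b free_cover_basis (SIB _ _ _ rho1) scale1r.
apply/SE; rewrite -[x]subr0 -quot_piE linear0 -Bx -[tens e x]wE; apply/eqP.
move: w {wE}; apply: tensor_ind => [|q y].
  exact: (submodule_preim _ (submodule_preim B (submodule_set0 _))).
rewrite tensor_map_tens /= tensor_lift_tens // /b free_cover_diff.
exact: SI.
Qed.

End TorZero.

Lemma fg_quotmod (R : comNzRingType) (J : ideal R) :
  finitely_generated (@predT (quotmod J)).
Proof.
exists [:: quot_pi J 1] => x; rewrite [RHS]inE; apply/lspan_spanE.
rewrite -(quot_piK x) /=; exists (repr x), 0; split=> //.
rewrite addr0 -linearZ; congr (quot_pi _ _).
by rewrite /GRing.scale /= mulr1.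
Qed.

(** The chain R a^n x is stationary, so a^n x = r a^(n+1) x for some n, and 1 - r a is a unit. *)
Lemma artinian_torsion (R : comNzRingType) (m : ideal R) (T : lmodType R) (a : R)
    (x : T) :
  local_ring m -> artinian T -> a \in m -> exists n, a ^+ n *: x = 0.
Proof.
move=> localR artT am.
have /choice[S SE] n := submodule_pred (submodule_lspan [:: a ^+ n *: x]).
have [n|n nP] := artT S.
  move=> y /SE/= [r [_ [-> ->]]]; apply/SE => /=; exists (r * a), 0; split=> //.
  by rewrite !addr0 exprS !scalerA mulrA.
exists n; have : a ^+ n *: x \in S n.+1.
  by rewrite nP //; apply/SE/mem_lspan; rewrite mem_head.
move/SE => /= [r [_ [-> xE]]]; rewrite addr0 in xE.
have [c cE] : exists c, c * (1 - r * a) = 1.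
  by apply: (local_unitB localR); apply: idealMl.
rewrite -[_ *: x]scale1r -cE -scalerA scalerBl scale1r {1}xE.
by rewrite exprS !scalerA mulrA subrr scaler0.
Qed.

Lemma prime_idealrX (R : comNzRingType) (p : prime_idealr R) (b : R) n :
  b ^+ n \in (p : {pred R}) -> b \in (p : {pred R}).
Proof.
elim: n => [|n IHn]; first by rewrite expr0 idealr1.
by rewrite exprS prime_idealrM => /orP[//|/IHn].
Qed.

Theorem theoremB (R : comNzRingType) (m I : ideal R) (M : preTopLmodType R)
    (N : lmodType R) (noethR : noetherian R) (localR : local_ring m)
    (compactM : linearly_compact m M) (discreteM : semi_discrete m M)
    (coartM : coartinian m I M) (fgN : finitely_generated (@predT N))
    (dimN : krull_dim_le N 2) (i : nat) :
  coartinian m I (Tor N M i).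
Proof.
(* Semi-discreteness makes all cosets closed, so compactness applies to every family of cosets. *)
have finM : fin_socles m M.
  apply: (compact_fin_socles localR) => F Fcoset; apply: compactM.2 => C /Fcoset.
  move=> [S [x [smS ->]]]; have [S' S'E] := submodule_pred smS.
  exists S'; first exact: discreteM.2.
  by exists x; apply/seteqP; split=> y /S'E.
have [s sP] := fin_socles_minimax noethR localR finM.
have torM : torsion_mod m I M.
  apply: (minimax_torsion_mod noethR sP) => a x am.
  have [F [F_lin F0]] := Tor0_quotient I M.
  have [k kP] := artinian_torsion (F x) localR (coartM.2 0%N) am.
  exists k; apply: F0; rewrite -kP.
  pose Fb := GRing.isLinear.Build R M (Tor (quotmod I) M 0%N) *:%R F F_lin.
  pose FL : {linear M -> Tor (quotmod I) M 0%N} := HB.pack F Fb.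
  exact: (linearZ_LR FL).
split=> [p [L [cocL [h surjh]] annp] b bI|j].
  suff [n bn] : exists n, forall y : L, b ^+ n *: y = 0.
    by apply: (@prime_idealrX _ _ _ n); apply: annp; apply/asboolP.
  have [E envE _] := cocL.
  have [bm|bm] := boolP (b \in m); last first.
    have M0 := cosupp_unit localR envE coartM.1 bI bm.
    have T0 := Tor_serre i noethR (trivial_serre R) fgN M0.
    by exists 0%N => y; have [x <-] := surjh y; rewrite (T0 x) linear0 scaler0.
  have powM := cosupp_power_fg noethR localR envE finM sP coartM.1 bI.
  have powT := Tor_serre i noethR (power_fg_serre noethR b) fgN powM.
  exact: (power_fg_cocyclic noethR bm powT cocL surjh).
set T := Tor (quotmod I) _ j.
(* A Serre class passes through Tor twice: from [M] to Tor_i(N, M), then to Tor_j(R/I, -) of it. *)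
have serreT C : serre_class C -> C M -> C T.
  move=> serreC /(Tor_serre i noethR serreC fgN).
  exact: (Tor_serre j noethR serreC (fg_quotmod I)).
have finT : fin_socles m T by apply: serreT finM; apply: fin_socles_serre.
have torT : torsion_mod m I T by apply: serreT torM; apply: torsion_mod_serre.
(* [I] annihilates [T], so the term [c] in [torsion_mod] disappears and [T] is m-torsion. *)
have torT0 (a : R) (x : T) : a \in m -> exists k, a ^+ k *: x = 0.
  move=> am; have [k [c [cI kc]]] := torT x a am; exists k.
  have cx : c *: x = 0.
    by apply: Tor_annihilator; apply/asboolP => q; apply: quotmod_annihilated.
  by rewrite -[LHS]subr0 -[in LHS]cx -scalerBl.
move=> S Sh.
have [||a x am|n nP] :=
    fin_socles_artinian noethR localR (S := fun n => [set x | x \in S n]) finT.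
- by move=> n; apply: submodule_mem.
- by move=> n x /= /Sh.
- by have [k k0] := torT0 a x am; exists k => n; rewrite /= k0 rpred0.
have Sm k l : (k <= l)%N -> {subset S l <= S k}.
  by move=> /subnK <-; elim: (l - k)%N => // e IHe x /Sh/IHe.
exists n => k nk x; apply/idP/idP; [exact: Sm|exact: nP].
Qed.
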